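(* Let $b\ge 2$ be an integer and $0<\alpha<\tfrac12$. Then a prevalent function $g\in\mathrm{Lip}(\mathbb{S}^1)$ satisfies $$\overline{\dim}_M\big((W_g^{\alpha,b})^{-1}(\{y\})\big)\le 1-\alpha\quad\text{for all } y\in\mathbb{R}.$$
   Context: $\mathbb{S}^1$ is identified with $\mathbb{R}/\mathbb{Z}$ (equivalently with $[0,1)$), and functions on $\mathbb{S}^1$ are $1$-periodic functions on $\mathbb{R}$. $\mathrm{Lip}(\mathbb{S}^1)$ is the Banach space of Lipschitz functions $g\colon\mathbb{S}^1\to\mathbb{R}$ with norm $\|g\|_{\mathrm{Lip}}=\sup_x|g(x)|+\sup_{x\ne y}\frac{|g(x)-g(y)|}{|x-y|}$. For an integer $b\ge2$, $0<\alpha\le 1$ and $g\in\mathrm{Lip}(\mathbb{S}^1)$, the Weierstrass function is $W_g^{\alpha,b}(x)=\sum_{k=0}^\infty b^{-\alpha k}g(b^kx)$, $x\in\mathbb{S}^1$. A subset $A$ of a Banach space $X$ is shy if there exist a Borel measure $\mu$ on $X$ and a Borel set $B\supset A$ such that $0<\mu(K)<\infty$ for some compact $K\subset X$ and $\mu(x+B)=0$ for all $x\in X$; a set is prevalent if its complement is shy, and ''a prevalent $g$ satisfies P'' means the set of $g$ satisfying P is prevalent. $\overline{\dim}_M$ denotes upper Minkowski (box-counting) dimension. *)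

(* Defs.v *)
From mathcomp Require Import all_boot all_order all_algebra.
From mathcomp Require Import all_classical all_reals all_analysis.
Import Order.TTheory GRing.Theory Num.Theory.

Set Implicit Arguments.
Unset Strict Implicit.
Unset Printing Implicit Defensive.

Local Open Scope classical_set_scope.
Local Open Scope ring_scope.

Section LipDefs.
Variable R : realType.

(** Functions on S^1 = R/Z are 1-periodic functions R -> R. *)
Definition periodic1 (g : R -> R) : Prop := forall x, g (x + 1) = g x.

Definition lipschitz_fun (g : R -> R) : Prop :=
  exists L : R, forall x y, `|g x - g y| <= L * `|x - y|.

Definition Lip : set (R -> R) := [set g | periodic1 g /\ lipschitz_fun g].

Definition sup_norm (g : R -> R) : R := sup [set `|g x| | x in [set: R]].

Definition lip_seminorm (g : R -> R) : R :=
  sup [set r | exists x y : R, x != y /\ r = `|g x - g y| / `|x - y|].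

Definition lip_norm (g : R -> R) : R := sup_norm g + lip_seminorm g.

Definition lip_open (U : set (R -> R)) : Prop :=
  U `<=` Lip /\
  forall g, U g -> exists e : R, 0 < e /\
    forall h, Lip h -> lip_norm (h \- g) < e -> U h.

Definition lip_compact (K : set (R -> R)) : Prop :=
  K `<=` Lip /\
  forall (I : Type) (U : I -> set (R -> R)),
    (forall i, lip_open (U i)) -> K `<=` \bigcup_(i in [set: I]) U i ->
    exists (n : nat) (f : 'I_n -> I), forall h, K h -> exists j, U (f j) h.

Definition lip_borel : set (set (R -> R)) := <<s Lip, lip_open >>.

Definition lip_borel_measure (mu : set (R -> R) -> \bar R) : Prop :=
  mu set0 = 0%E /\
  (forall A, lip_borel A -> (0 <= mu A)%E) /\
  (forall F : nat -> set (R -> R), (forall n, lip_borel (F n)) ->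
     trivIset [set: nat] F ->
     (fun n => (\sum_(0 <= k < n) mu (F k))%E) @ \oo --> mu (\bigcup_n F n)).

Definition translate (x : R -> R) (B : set (R -> R)) : set (R -> R) :=
  [set x \+ h | h in B].

Definition lip_shy (A : set (R -> R)) : Prop :=
  exists (mu : set (R -> R) -> \bar R) (B : set (R -> R)),
    [/\ lip_borel_measure mu, lip_borel B, A `<=` B,
        (exists K, lip_compact K /\ (0 < mu K)%E /\ (mu K < +oo)%E) &
        forall x, Lip x -> mu (translate x B) = 0%E].

Definition lip_prevalent (P : (R -> R) -> Prop) : Prop :=
  lip_shy [set g | Lip g /\ ~ P g].

Definition weierstrass (alpha : R) (b : nat) (g : R -> R) (x : R) : R :=
  limn (fun n => \sum_(0 <= k < n) ((b%:R `^ (- (alpha * k%:R))) * g (b%:R ^+ k * x))).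

Definition mesh_count (d : R) (E : set R) : \bar R :=
  esum [set k : int | exists x, E x /\ k%:~R * d <= x < (k + 1)%:~R * d]
       (fun _ => 1%E).

Definition box_ratio (d : R) (E : set R) : \bar R :=
  match mesh_count d E with
  | r%:E => (ln r / - ln d)%:E
  | _ => +oo%E
  end.

Definition upper_minkowski_dim (E : set R) : \bar R :=
  ereal_inf [set ereal_sup [set box_ratio d E | d in [set d : R | 0 < d < eta]]
            | eta in [set eta : R | 0 < eta < 1]].

(** Level set (W)^{-1}({y}) as a subset of S^1 = [0,1). *)
Definition level_set (f : R -> R) (y : R) : set R :=
  [set x | 0 <= x < 1 /\ f x = y].

End LipDefs.

(* Main.v *)
Require Import Defs.
From mathcomp Require Import all_boot all_order all_algebra.
From mathcomp Require Import all_classical all_reals all_analysis.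
From mathcomp Require Import measurable_realfun ring lra zify.
Import Order.TTheory GRing.Theory Num.Theory.
Import numFieldNormedType.Exports.
Set Implicit Arguments.
Unset Strict Implicit.
Unset Printing Implicit Defensive.
Local Open Scope classical_set_scope.
Local Open Scope ring_scope.

(** Occupation counts of W_g are controlled by exponential sums. A Fejer kernel
    bounds, uniformly in y, the number of points k / b^n with W_g(k / b^n) close
    to y, at scale b^(- alpha n), by the average over the frequencies
    j < b^(alpha n) of |sum_k exp(i j W_g(k / b^n))|. Since W_g is
    alpha-Hoelder, a bound b^(n (1 - alpha)) up to powers of n for this count
    bounds the dimension of every level set by 1 - alpha.

    The probe is the law of h = sum_i t_i phi_i with independent uniform t_i and
    finitely many sawtooth functions phi_i, chosen such that for all close x, y
    some i satisfies |W_(phi_i)(x) - W_(phi_i)(y)| >= c |x - y|^alpha. Then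
    E exp(i j (W_(g+h)(x) - W_(g+h)(y))) is O(j^-2 |x - y|^(- 2 alpha)), and as
    2 alpha < 1 this is summable over pairs of grid points up to a logarithm.
    Hence the expected square of the j-th exponential sum is O(b^(2n) j^-2), up
    to powers of n, for every fixed g, and Markov's inequality together with the
    Borel-Cantelli argument makes the set of bad functions null for every
    translate of the probe. *)

(** * Sawtooth functions *)

(** The levels [y] are uncountable, so no union bound over [y] is available; the Fejer kernel
    replaces it because the modulus of an exponential sum does not change when all values are
    shifted by [y]. The hypothesis alpha < 1/2 is spent twice: |x - y|^(2 alpha) >= |x - y| turns
    the off-diagonal pairs into harmonic sums, and the squared frequency cut-off b^(2 alpha n) <=
    b^n keeps the diagonal pairs within the same bound. Separation works because a suitable power of
    b magnifies the interval from x to y until it covers a whole short cell of the circle. The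
    sawtooth of that cell rises steeply there and falls slowly elsewhere, so one term of the series
    outweighs all others. Shyness asks for a single Borel set that is null under every translate.
    The set is therefore described by energies of the function alone, which are continuous for the
    Lipschitz norm, with only integer quantifiers around them. A translation of the probe changes
    the phase of a cosine, never the decay of the characteristic function. *)

Section Sawtooth.
Variables (R : realType) (l : R).
Hypotheses (l_gt0 : 0 < l) (l_lt1 : l < 1).

(* The primitive vanishing at 0 of the indicator function of [0, l] + Z. *)
Definition staircase (s : R) : R :=
  l * (Num.floor s)%:~R + Num.min (s - (Num.floor s)%:~R) l.

Definition sawtooth (s : R) : R := staircase s - l * s.

Lemma floor_step (s t : R) : s <= t ->
  Num.floor s = Num.floor t \/ (Num.floor s)%:~R + 1 <= (Num.floor t)%:~R :> R.
Proof.
move=> st; have := le_floor st; rewrite le_eqVlt => /orP[/eqP->|]; first by left.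
by rewrite -lezD1 -(ler_int R) intrD => ?; right.
Qed.

Lemma staircase_le (s t : R) : s <= t -> staircase s <= staircase t.
Proof.
move=> st; rewrite /staircase.
have := floor_le s; have := floorD1_gt s.
have := floor_le t; have := floorD1_gt t.
case: (floor_step st) => [->|]; rewrite !intrD.
  by move=> *; case: (lerP (s - _) l) => ?; case: (lerP (t - _) l) => ?; lra.
set i : R := (Num.floor s)%:~R; set j : R := (Num.floor t)%:~R => ij *.
have : l * (i + 1) <= l * j by rewrite ler_pM2l.
have ? := l_gt0; have ? := l_lt1; move=> ?.
by case: (lerP (s - _) l) => ?; case: (lerP (t - _) l) => ?; lra.
Qed.

(** [s - staircase s] is the primitive of the complementary indicator, so the argument for
    [staircase_le] applies with [1 - l] in place of [l]. *)
Lemma staircase_sub_le (s t : R) : s <= t -> staircase t - staircase s <= t - s.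
Proof.
move=> st; rewrite /staircase.
have := floor_le s; have := floorD1_gt s.
have := floor_le t; have := floorD1_gt t.
case: (floor_step st) => [->|]; rewrite !intrD.
  by move=> *; case: (lerP (s - _) l) => ?; case: (lerP (t - _) l) => ?; lra.
set i : R := (Num.floor s)%:~R; set j : R := (Num.floor t)%:~R => ij *.
have : (1 - l) * (i + 1) <= (1 - l) * j by rewrite ler_pM2l// subr_gt0.
have ? := l_gt0; have ? := l_lt1; move=> ?.
by case: (lerP (s - _) l) => ?; case: (lerP (t - _) l) => ?; lra.
Qed.

Lemma sawtooth_periodic : periodic1 sawtooth.
Proof.
move=> s; rewrite /sawtooth /staircase.
by rewrite floorDrz ?rpred1// floor1 intrD opprD addrACA subrr addr0; ring.
Qed.

Lemma sawtooth_bound (s : R) : 0 <= sawtooth s <= l.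
Proof.
rewrite /sawtooth /staircase.
have := floor_le s; have := floorD1_gt s; rewrite intrD.
set i : R := (Num.floor s)%:~R => s1 s0.
have ? : 0 <= l * (s - i) by rewrite mulr_ge0 ?subr_ge0// ltW.
have ? : l * (s - i) <= l * 1 by rewrite ler_pM2l//; lra.
have ? : 0 <= (1 - l) * (s - i) by rewrite mulr_ge0 ?subr_ge0// ltW.
by have ? := l_gt0; apply/andP; case: (lerP (s - i) l) => ?; split; lra.
Qed.

(** The slope is never below [- l]. This bounds what the other terms of the series can lose when one
    term gains. *)
Lemma sawtooth_drop (s t : R) : s <= t ->
  - (l * (t - s)) <= sawtooth t - sawtooth s.
Proof. by move=> /staircase_le; rewrite /sawtooth; lra. Qed.

(** The whole rising cell [[i, i + l]] lies between [s] and [t], so the staircase gains its full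
    step [l]. *)
Lemma sawtooth_rise (s t : R) (i : int) : s <= i%:~R -> i%:~R + l <= t ->
  l - l * (t - s) <= sawtooth t - sawtooth s.
Proof.
move=> /staircase_le si /staircase_le it; rewrite /sawtooth.
suff : staircase (i%:~R + l) - staircase i%:~R = l by lra.
have il : Num.floor (i%:~R + l) = i.
  apply: floor_def; rewrite intrD.
  by rewrite lerDl (ltW l_gt0) ltrD2l.
rewrite /staircase il intrKfloor subrr (min_l (ltW l_gt0)) (addrC _ l) addrK.
by rewrite minxx addr0 addrAC subrr add0r.
Qed.

Lemma sawtooth_lipschitz (s t : R) : `|sawtooth s - sawtooth t| <= `|s - t|.
Proof.
wlog st : s t / s <= t.
  move=> H; have [/H//|/ltW /H] := leP s t.
  by rewrite distrC (distrC t).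
have := staircase_le st; have := staircase_sub_le st; rewrite /sawtooth => h1 h2.
have ? : 0 <= l * (t - s) <= t - s.
  by rewrite mulr_ge0 ?subr_ge0 ?(ltW l_gt0)//= ler_piMl ?subr_ge0 ?(ltW l_lt1).
by rewrite (distrC s t) (ger0_norm (x := t - s)) ?subr_ge0// ler_norml; lra.
Qed.

End Sawtooth.

(** * Weierstrass functions of the probes *)

Section TwoSidedGeometric.
Variables (R : realType) (B beta : R).
Hypotheses (beta_gt0 : 0 < beta) (beta_lt1 : beta < 1) (B_gt0 : 0 < B)
  (Bbeta_gt1 : 1 < B * beta).

(** Up to index [m] the second bound grows geometrically with ratio [B * beta], beyond [m] the first
    one decays with ratio [beta]; both sums are governed by their terms near [m]. The bounds on [c]
    are one-sided so that gains need no control. *)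
Lemma sum_two_sided_geometric (c : nat -> R) (A L d : R) (m K : nat) :
  0 <= A -> 0 <= L -> 0 <= d -> B ^+ m * d <= 1 ->
  (forall k, c k <= A * beta ^+ k) ->
  (forall k, c k <= L * (beta ^+ k * (B ^+ k * d))) ->
  \sum_(0 <= k < K) c k <=
    beta ^+ m * (L * (B * beta / (B * beta - 1)) + A * (beta / (1 - beta))).
Proof.
move=> A0 L0 d0 md cA cL; set q := B * beta.
have q1 : 0 < q - 1 by rewrite subr_gt0.
have q0 : 0 < q by rewrite (lt_trans _ Bbeta_gt1).
have b1 : 0 < 1 - beta by rewrite subr_gt0.
have low n : \sum_(0 <= k < n) c k <= L * d * (q ^+ n / (q - 1)).
  elim: n => [|n IHn].
    by rewrite big_geq// expr0 !mulr_ge0 ?invr_ge0 ?(ltW q1).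
  rewrite big_nat_recr//= (le_trans (lerD IHn (cL n)))//.
  rewrite le_eqVlt; apply/orP; left; apply/eqP.
  rewrite exprS /q exprMn; field; rewrite -/q; exact: lt0r_neq0.
have lowm n : (n <= m.+1)%N ->
    \sum_(0 <= k < n) c k <= beta ^+ m * (L * (q / (q - 1))).
  move=> nm; apply: le_trans (low n) _.
  apply: (@le_trans _ _ (L * d * (q ^+ m.+1 / (q - 1)))).
    rewrite ler_wpM2l ?mulr_ge0// ler_pM2r ?invr_gt0//.
    by rewrite ler_weXn2l// ltW.
  have -> : L * d * (q ^+ m.+1 / (q - 1)) =
      beta ^+ m * (L * (q / (q - 1))) * (B ^+ m * d).
    by rewrite exprS /q exprMn; field; rewrite -/q; exact: lt0r_neq0.
  by rewrite ler_piMr// !mulr_ge0// ?exprn_ge0 ?invr_ge0 ?(ltW q1) ?(ltW q0)// ltW.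
have tail j : \sum_(0 <= k < m.+1 + j) c k <= beta ^+ m * (L * (q / (q - 1))) +
    beta ^+ m * (A * (beta / (1 - beta))) * (1 - beta ^+ j).
  elim: j => [|j IHj]; first by rewrite addn0 expr0 subrr mulr0 addr0 lowm.
  rewrite addnS big_nat_recr//= (le_trans (lerD IHj (cA _)))//.
  rewrite le_eqVlt; apply/orP; left; apply/eqP.
  by rewrite addSn !exprS exprD; field; rewrite !lt0r_neq0.
have Ab : 0 <= beta ^+ m * (A * (beta / (1 - beta))).
  by rewrite !mulr_ge0// ?exprn_ge0// ?invr_ge0 ?(ltW b1)// ltW.
rewrite mulrDr; have [Km|mK] := leqP K m.+1.
  by rewrite (le_trans (lowm _ Km))// lerDl.
rewrite -(subnKC (ltnW mK)) (le_trans (tail _))// lerD2l ler_piMr//.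
by rewrite gerBl exprn_ge0// ltW.
Qed.

End TwoSidedGeometric.
(** [m] is maximal for the first inequality; the search is finite because [m < b ^ m]. *)
Lemma scale_of_distance (R : realType) (b : nat) (d : R) : (2 <= b)%N -> 0 < d <= 1 ->
  exists m : nat, b%:R ^+ m * d <= 1 /\ 1 < b%:R ^+ m.+1 * d.
Proof.
move=> b_ge2 /andP[d0 d1].
have ex : exists m, b%:R ^+ m * d <= 1 by exists 0; rewrite expr0 mul1r.
have bd m : b%:R ^+ m * d <= 1 -> (m <= Num.trunc d^-1)%N.
  rewrite -ler_pdivlMr// mul1r => bm.
  rewrite -ltnS -(ltr_nat R) (le_lt_trans _ (truncnS_gt _))//.
  rewrite (le_trans _ bm)// -natrX ler_nat ltnW// ltn_expl//.
case: (ex_maxnP ex bd) => m mP mmax; exists m; split => //.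
by rewrite ltNge; apply/negP => /mmax; rewrite ltnn.
Qed.

Section Weierstrass.
Variables (R : realType) (b : nat) (alpha : R).
Hypotheses (b_ge2 : (2 <= b)%N) (alpha_gt0 : 0 < alpha) (alpha_lt : alpha < 1 / 2).
Local Notation beta := ((b%:R : R) `^ (- alpha)).
Local Notation W := (weierstrass alpha b).

Lemma ratio_gt0 : 0 < beta.
Proof. by rewrite powR_gt0// ltr0n; lia. Qed.

Lemma base_gt1 : 1 < b%:R :> R.
Proof. by rewrite ltr1n. Qed.

Lemma ratio_lt1 : beta < 1.
Proof.
have b0 : 0 < b%:R :> R by rewrite (lt_trans _ base_gt1).
rewrite powRN invf_lt1 ?powR_gt0//.
have := @gt0_ltr_powR R alpha alpha_gt0 1 b%:R; rewrite powR1.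
by apply; rewrite ?nnegrE ?base_gt1 ?(ltW b0).
Qed.

(* This is where [alpha < 1/2] enters. *)
Lemma base_ratio_sq_ge1 : 1 <= b%:R * beta ^+ 2.
Proof.
have b0 : 0 < b%:R :> R by rewrite (lt_trans _ base_gt1).
rewrite -powR_mulrn ?powR_ge0// -powRrM -{1}(powRr1 (ltW b0)) -powRD; last first.
  by rewrite (gt_eqF b0) implybT.
by have ? := alpha_lt; rewrite -[leLHS](powRr0 (b%:R : R)) ler_powR ?(ltW base_gt1)//; lra.
Qed.

Lemma base_ratio_gt1 : 1 < b%:R * beta.
Proof.
rewrite (le_lt_trans base_ratio_sq_ge1)// expr2 mulrA gtr_pMr ?ratio_lt1//.
by rewrite mulr_gt0 ?ratio_gt0// (lt_trans _ base_gt1).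
Qed.

Definition weierstrass_partial (g : R -> R) (x : R) (n : nat) : R :=
  \sum_(0 <= k < n) beta ^+ k * g (b%:R ^+ k * x).

Lemma weierstrassE (g : R -> R) (x : R) : W g x = limn (weierstrass_partial g x).
Proof.
rewrite /weierstrass; congr (limn _); apply/funext => n; rewrite /weierstrass_partial.
by apply: eq_bigr => k _; rewrite -mulNr powRrM powR_mulrn ?powR_ge0.
Qed.

Lemma cvg_partial (g : R -> R) (A x : R) : (forall z, `|g z| <= A) ->
  cvgn (weierstrass_partial g x).
Proof.
move=> gA; apply: normed_cvg.
apply: (@series_le_cvg _ _ (geometric A beta)) => //.
- by move=> n /=.
- by move=> n; rewrite /= mulr_ge0// ?(le_trans _ (gA 0))// exprn_ge0// ltW// ratio_gt0.
- move=> n /=; rewrite normrM ger0_norm ?exprn_ge0 ?(ltW ratio_gt0)// mulrC.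
  by rewrite ler_wpM2r// exprn_ge0// ltW// ratio_gt0.
- by apply: is_cvg_geometric_series; rewrite ger0_norm ?ratio_lt1// ltW// ratio_gt0.
Qed.

Lemma weierstrassD (g h : R -> R) (A A' x : R) : (forall z, `|g z| <= A) ->
  (forall z, `|h z| <= A') -> W (g \+ h) x = W g x + W h x.
Proof.
move=> gA hA; rewrite !weierstrassE -limD; [|exact: cvg_partial gA|exact: cvg_partial hA].
congr (limn _); apply/funext => n; rewrite /= ?fctE /weierstrass_partial.
by rewrite -big_split/=; apply: eq_bigr => k _; rewrite mulrDr.
Qed.

Lemma weierstrassZ (a : R) (g : R -> R) (A x : R) : (forall z, `|g z| <= A) ->
  W (fun z => a * g z) x = a * W g x.
Proof.
move=> gA; rewrite !weierstrassE.
rewrite -[RHS](@limZr _ R _ _ _ _ _ (cvg_partial (x := x) gA)).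
congr (limn _); apply/funext => n; rewrite /= ?fctE /weierstrass_partial scaler_sumr.
by apply: eq_bigr => k _; rewrite mulrCA.
Qed.

(** Signed, and for large [K] only: the separation argument bounds partial sums that already contain
    the decisive term. *)
Lemma weierstrass_sub_le (g : R -> R) (A x y C : R) (K0 : nat) :
  (forall z, `|g z| <= A) ->
  (forall K, (K0 <= K)%N ->
    \sum_(0 <= k < K) beta ^+ k * (g (b%:R ^+ k * x) - g (b%:R ^+ k * y)) <= C) ->
  W g x - W g y <= C.
Proof.
move=> gA HC; rewrite !weierstrassE -limB; try exact: cvg_partial gA.
apply: limr_le; first by apply: is_cvgB; exact: cvg_partial gA.
exists K0 => // K /= K0K; rewrite (le_trans _ (HC K K0K))// fctE /weierstrass_partial -sumrB.
by rewrite le_eqVlt; apply/orP; left; apply/eqP/eq_bigr => k _; rewrite mulrBr.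
Qed.

Lemma weierstrass_bound (g : R -> R) (A x : R) : (forall z, `|g z| <= A) ->
  `|W g x| <= A / (1 - beta).
Proof.
move=> gA; have b0 := ratio_gt0; have b1 := ratio_lt1.
have A0 : 0 <= A by rewrite (le_trans _ (gA 0)).
have pA n : `|weierstrass_partial g x n| <= A / (1 - beta) * (1 - beta ^+ n).
  elim: n => [|n IHn]; first by rewrite /weierstrass_partial big_geq// expr0 subrr mulr0 normr0.
  rewrite /weierstrass_partial big_nat_recr//= (le_trans (ler_normD _ _))//.
  rewrite (le_trans (lerD IHn (_ : _ <= A * beta ^+ n)))//.
    by rewrite normrM ger0_norm ?exprn_ge0 ?(ltW b0)// mulrC ler_wpM2r// exprn_ge0// ltW.
  rewrite le_eqVlt; apply/orP; left; apply/eqP.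
  by rewrite exprS; field; rewrite subr_eq0 gt_eqF.
have {}pA n : `|weierstrass_partial g x n| <= A / (1 - beta).
  rewrite (le_trans (pA n))// ler_piMr ?gerBl ?exprn_ge0 ?(ltW b0)//.
  by rewrite divr_ge0// subr_ge0 ltW.
rewrite weierstrassE ler_norml; apply/andP; split.
  apply: limr_ge; first exact: cvg_partial gA.
  by apply: nearW => n; have := pA n; rewrite ler_norml => /andP[].
apply: limr_le; first exact: cvg_partial gA.
by apply: nearW => n; have := pA n; rewrite ler_norml => /andP[].
Qed.


Let base_gt0 : 0 < b%:R :> R. Proof. by rewrite ltr0n; lia. Qed.

(** The sum of [(b * beta) ^- k] over k >= 0; [tail_const] is the sum of [beta ^+ k] over k >= 1. *)
Definition rise_const : R := b%:R * beta / (b%:R * beta - 1).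
Definition tail_const : R := beta / (1 - beta).

Let two_sided := sum_two_sided_geometric ratio_gt0 ratio_lt1 base_gt0 base_ratio_gt1.

Lemma weierstrass_hoelder (g : R -> R) (A L x y : R) (n : nat) :
  (forall z, `|g z| <= A) -> (forall u v, `|g u - g v| <= L * `|u - v|) ->
  b%:R ^+ n * `|x - y| <= 1 ->
  `|W g x - W g y| <= beta ^+ n * (L * rise_const + 2 * A * tail_const).
Proof.
move=> gA gL xyn.
have beta0 := ratio_gt0.
have A0 : 0 <= A by rewrite (le_trans _ (gA 0)).
have L0 : 0 <= L.
  by have := gL 1 0; rewrite subr0 normr1 mulr1; apply: le_trans.
suff oneside u v : `|u - v| = `|x - y| ->
    W g u - W g v <= beta ^+ n * (L * rise_const + 2 * A * tail_const).
  by rewrite ler_norml lerNl opprB !oneside// distrC.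
move=> uv; apply: (weierstrass_sub_le (K0 := 0) gA) => K _.
apply: (two_sided (d := `|x - y|)) => // [|k|k].
- by rewrite mulr_ge0.
- rewrite mulrC ler_wpM2r ?exprn_ge0 ?(ltW beta0)//.
  have := gA (b%:R ^+ k * u); have := gA (b%:R ^+ k * v).
  by rewrite !ler_norml => /andP[? ?] /andP[? ?]; lra.
- rewrite mulrCA ler_wpM2l ?exprn_ge0 ?(ltW beta0)//.
  rewrite (le_trans (ler_norm _))// (le_trans (gL _ _))// -mulrBr normrM uv.
  by rewrite ger0_norm ?exprn_ge0// ltW.
Qed.

Variable J0 : nat.
Hypothesis J0_large : rise_const + tail_const + 1 <= (beta ^+ J0)^-1.

Definition mesh : R := (b%:R ^+ J0.+2)^-1.
(* The derivative of [probe q] is [1 - mesh] on the [q]-th mesh cell and [- mesh]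
   elsewhere, so that terms of the Weierstrass series other than the one that
   sees this cell contribute almost nothing negative. *)
Definition probe (q : nat) (s : R) : R := sawtooth mesh (s - q%:R * mesh).

Lemma mesh_gt0 : 0 < mesh.
Proof. by rewrite invr_gt0 exprn_gt0. Qed.

Lemma mesh_lt1 : mesh < 1.
Proof. by rewrite invf_lt1 ?exprn_gt0// exprn_egt1// base_gt1. Qed.

Lemma probe_periodic q : periodic1 (probe q).
Proof. by move=> x; rewrite /probe addrAC sawtooth_periodic// mesh_lt1. Qed.

Lemma probe_bound q s : 0 <= probe q s <= mesh.
Proof. by rewrite sawtooth_bound ?mesh_gt0 ?mesh_lt1. Qed.

Lemma probe_norm_le1 q s : `|probe q s| <= 1.
Proof.
have /andP[p0 p1] := probe_bound q s.
by rewrite ger0_norm// (le_trans p1)// ltW// mesh_lt1.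
Qed.

Lemma probe_lipschitz q s t : `|probe q s - probe q t| <= `|s - t|.
Proof.
rewrite (le_trans (sawtooth_lipschitz _ _ _ _)) ?mesh_gt0 ?mesh_lt1//.
by rewrite opprB addrA subrK.
Qed.

Lemma probe_separates (x y : R) : x < y -> y - x <= (b%:R ^+ J0)^-1 ->
  exists2 q, (q < b ^ J0.+2)%N &
    mesh ^+ 2 * (y - x) <= (W (probe q) y - W (probe q) x) ^+ 2.
Proof.
move=> xy xyJ; set d := y - x; have bpos : (0 < b)%N by exact: ltnW.
have beta0 := ratio_gt0; have beta1 := ratio_lt1.
have l0 := mesh_gt0; have l1 := mesh_lt1; have b1 := base_gt1.
have d0 : 0 < d by rewrite subr_gt0.
have d1 : d <= 1.
  by rewrite (le_trans xyJ)// invf_le1 ?exprn_gt0// exprn_ege1// ltW.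
have [|m [md md1]] := scale_of_distance (d := d) b_ge2; first by rewrite d0.
have Jm : (J0 <= m)%N.
  rewrite -ltnS; have : 1 < b%:R ^+ m.+1 / b%:R ^+ J0 :> R.
    by rewrite (lt_le_trans md1)// ler_pM2l// exprn_gt0.
  by rewrite ltr_pdivlMr ?exprn_gt0// mul1r ltr_eXn2l.
(* Magnified by [b ^ k0], the interval is longer than [b ^- J0.+1], which is at least two mesh
   widths as [b >= 2]. It thus contains a whole mesh cell; this explains the exponent [J0.+2] in
   [mesh]. *)
set k0 := (m - J0)%N.
have bk0 : b%:R ^+ m = b%:R ^+ k0 * b%:R ^+ J0 :> R by rewrite -exprD subnK.
have len : 2 * mesh <= b%:R ^+ k0 * d.
  rewrite /mesh; have := ltW md1; rewrite exprS bk0 => md2.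
  have {}md2 : (b%:R * b%:R ^+ J0)^-1 <= b%:R ^+ k0 * d.
    rewrite -[leLHS]mul1r ler_pdivrMr ?mulr_gt0 ?exprn_gt0// (le_trans md2)//.
    by rewrite le_eqVlt; apply/orP; left; apply/eqP; ring.
  rewrite (le_trans _ md2)// !exprS invfM mulrA.
  rewrite ler_piMl ?invr_ge0 ?mulr_ge0 ?exprn_ge0 ?(ltW base_gt0)//.
  by rewrite ler_pdivrMr// mul1r ler_nat.
(* [z * mesh] is the first mesh point from [b ^ k0 * x] on. Division of [z] by the number [Q] of
   cells per period yields the cell [q] and the period [i]. *)
pose z := Num.ceil (b%:R ^+ k0 * x / mesh).
pose Q := (b ^ J0.+2)%N.
pose q := `|(z %% Q)%Z|%N; pose i := (z %/ Q)%Z.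
have zE : z%:~R * mesh = q%:R * mesh + i%:~R.
  have Q0 : (0 < Q%:Z)%R by rewrite ltz_nat expn_gt0 bpos.
  have qE : q%:R = (z %% Q)%Z%:~R :> R.
    by rewrite -[LHS]/(q%:Z%:~R) gez0_abs// modz_ge0// gt_eqF.
  rewrite qE [in LHS](divz_eq z Q) intrD intrM mulrDl addrC; congr (_ + _).
  have -> : (Q%:Z)%:~R = b%:R ^+ J0.+2 :> R by rewrite -natrX.
  by rewrite -mulrA mulfV ?mulr1// gt_eqF// exprn_gt0.
exists q.
  rewrite -ltz_nat gez0_abs; first by rewrite ltz_pmod// ltz_nat expn_gt0 bpos.
  by rewrite modz_ge0// -[0]/(0%:Z) eqz_nat -lt0n expn_gt0 bpos.
have x0z : b%:R ^+ k0 * x <= z%:~R * mesh by rewrite -ler_pdivrMr// ceil_ge.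
have zy0 : z%:~R * mesh + mesh <= b%:R ^+ k0 * y.
  have : z%:~R * mesh < b%:R ^+ k0 * x + mesh.
    have : z%:~R < b%:R ^+ k0 * x / mesh + 1 
      by have := ceilB1_lt (b%:R ^+ k0 * x / mesh); rewrite -/z intrB ltrBlDr.
    by rewrite -(ltr_pM2r l0) mulrDl mul1r divfK// gt_eqF.
  by move: len; rewrite /d mulrBr; lra.
(* The term [k0 = m - J0] contributes [mesh * beta ^+ k0], which dominates the
   possible loss [mesh * beta ^+ m * (rise_const + tail_const)] of all the others. *)
suff low : W (probe q) x - W (probe q) y <= - (mesh * beta ^+ m).
  have : mesh * beta ^+ m <= W (probe q) y - W (probe q) x by lra.
  move=> lowm; have low0 : 0 <= mesh * beta ^+ m by rewrite mulr_ge0 ?exprn_ge0 ?ltW.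
  rewrite (@le_trans _ _ ((mesh * beta ^+ m) ^+ 2))//; last first.
    by rewrite lerXn2r ?nnegrE// (le_trans low0).
  rewrite exprMn ler_pM2l ?exprn_gt0//.
  (* Since [b ^+ m * d <= 1], this gives [d <= beta ^+ m ^+ 2]: the squared gap is at least linear
     in the distance. *)
  have := exprn_ege1 m base_ratio_sq_ge1; rewrite exprMn -exprM mulnC exprM => H.
  have := ler_wpM2r (ltW d0) H; rewrite mul1r => /le_trans; apply.
  by rewrite mulrAC ler_piMl// exprn_ge0// exprn_ge0// ltW.
apply: (weierstrass_sub_le (K0 := k0.+1) (probe_norm_le1 q)) => K kK.
(* Adding the gain back at [k0] leaves terms that satisfy both bounds of [two_sided] with
   [A = L = mesh]. *)
pose c k := beta ^+ k * (probe q (b%:R ^+ k * x) - probe q (b%:R ^+ k * y))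
  + (if k == k0 then beta ^+ k * mesh else 0).
have -> : \sum_(0 <= k < K) beta ^+ k * (probe q (b%:R ^+ k * x) - probe q (b%:R ^+ k * y))
   = \sum_(0 <= k < K) c k - beta ^+ k0 * mesh.
  rewrite /c big_split/= -big_mkcond/= big_nat1_eq/= kK addrK//.
have drop k : probe q (b%:R ^+ k * x) - probe q (b%:R ^+ k * y)
    + (if k == k0 then mesh else 0) <= mesh * (b%:R ^+ k * d).
  have le_xy : b%:R ^+ k * x - q%:R * mesh <= b%:R ^+ k * y - q%:R * mesh.
    by rewrite lerD2r ler_pM2l ?exprn_gt0// ltW.
  have dE : mesh * (b%:R ^+ k * d) =
      mesh * (b%:R ^+ k * y - q%:R * mesh - (b%:R ^+ k * x - q%:R * mesh)).
    by rewrite /d; ring.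
  case: eqP => [kE|_]; rewrite dE /probe.
    have := @sawtooth_rise R mesh l0 l1 (b%:R ^+ k * x - q%:R * mesh)
      (b%:R ^+ k * y - q%:R * mesh) i.
    rewrite kE lerBlDl -zE => /(_ x0z) H.
    by have {}H := H ltac:(lra); lra.
  by rewrite addr0; have := sawtooth_drop l0 l1 le_xy; lra.
have cE k : c k = beta ^+ k * (probe q (b%:R ^+ k * x) - probe q (b%:R ^+ k * y)
    + (if k == k0 then mesh else 0)).
  by rewrite /c; case: ifP => _; rewrite [RHS]mulrDr ?mulr0.
have sumc : \sum_(0 <= k < K) c k <= beta ^+ m * (mesh * rise_const + mesh * tail_const).
  apply: (two_sided (d := d)) => // [| | |k|k]; rewrite ?(ltW l0) ?(ltW d0)//.
  - rewrite cE mulrC ler_pM2r ?exprn_gt0//.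
    case: eqP => [->|_]; last first.
      have /andP[? ?] := probe_bound q (b%:R ^+ k * x).
      by have /andP[? ?] := probe_bound q (b%:R ^+ k * y); lra.
    have := drop k0; rewrite eqxx => /le_trans; apply.
    rewrite ler_piMr ?(ltW l0)// (le_trans _ md)// ler_pM2r//.
    by rewrite ler_eXn2l// /k0 leq_subr.
  - by rewrite cE mulrCA ler_pM2l ?exprn_gt0// drop.
have : beta ^+ m * mesh * (rise_const + tail_const + 1) <= beta ^+ k0 * mesh.
  have -> : beta ^+ k0 = beta ^+ m * (beta ^+ J0)^-1.
    by rewrite -(subnK Jm) exprD mulfK// gt_eqF// exprn_gt0.
  rewrite mulrAC ler_pM2r// ler_pM2l ?exprn_gt0//.
lra.
Qed.

End Weierstrass.

(** * Independent uniform coefficients *)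

Section UniformCoefficients.
Variable R : realType.

Lemma integral_cst_probability d (T : measurableType d) (P : probability T R) (r : R) :
  (\int[P]_w r%:E = r%:E)%E.
Proof.
by rewrite integral_cst//= probability_setT mule1.
Qed.

(** Keeps the coefficients in [0, 1] at every sample point and not just almost surely. *)
Definition clamp01 (u : R) : R := Num.max 0 (Num.min 1 u).

Lemma clamp01_itv u : (0 <= clamp01 u <= 1).
Proof. by rewrite /clamp01 le_max lexx/= ge_max ler01/= ge_min lexx. Qed.

Lemma clamp01_id u : (0 <= u <= 1) -> clamp01 u = u.
Proof. by move=> /andP[u0 u1]; rewrite /clamp01 min_r// max_r. Qed.

Lemma measurable_clamp01 : measurable_fun setT clamp01.
Proof. by apply: measurable_maxr => //; apply: measurable_minr. Qed.

(* The characteristic function of the uniform law on [0, 1] at [theta] is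
   [exp (i theta / 2) * uniform_decay theta]. *)
Definition uniform_decay (theta : R) : R :=
  if theta == 0 then 1 else (2 * sin (theta / 2) / theta).

Lemma measurable_cos_comp d (T : measurableType d) (f : T -> R) :
  measurable_fun setT f -> measurable_fun setT (fun w => cos (f w)).
Proof.
move=> mf; apply: measurableT_comp => //.
by apply: continuous_measurable_fun; exact: continuous_cos.
Qed.

Lemma integrable_cos_comp d (T : measurableType d) (P : probability T R) (f : T -> R) :
  measurable_fun setT f -> P.-integrable setT (fun w => (cos (f w))%:E).
Proof.
move=> mf; apply: measurable_bounded_integrable => //.
- by rewrite (le_lt_trans (probability_le1 P measurableT))// ltry.
- exact: measurable_cos_comp.
- exists 1; split => // M M1 w _ /=.
  by rewrite (le_trans (cos_max _))// ltW.
Qed.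

Lemma uniform_cos (c theta : R) :
  (\int[uniform_prob (@ltr01 R)]_u (cos (c + theta * clamp01 u))%:E =
  (uniform_decay theta * cos (c + theta / 2))%:E)%E.
Proof.
set P := uniform_prob _.
have mf : measurable_fun setT (fun u => (c + theta * clamp01 u)).
  by apply: measurable_funD => //; apply: measurable_funM => //; exact: measurable_clamp01.
(* [integral_uniform] asks for a nonnegative integrand, hence the added 1, which is removed at the
   end. *)
have shifted : (\int[P]_u (1 + cos (c + theta * clamp01 u))%:E =
    (1 + uniform_decay theta * cos (c + theta / 2))%:E)%E.
  rewrite integral_uniform; last 2 first.
  - apply/measurable_EFinP; apply: measurable_funD => //.
    exact: measurable_cos_comp.
  - by move=> u; rewrite lee_fin -lerBlDl sub0r cos_geN1.
  rewrite subr0 invr1 mul1e.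
  under eq_integral => u.
    rewrite inE/= in_itv/= => /clamp01_id ->; over.
  rewrite /uniform_decay; case: eqP => [->|/eqP t0].
    under eq_integral do rewrite mul0r.
    rewrite integral_cst//= lebesgue_measure_itv/= lte_fin ltr01 -EFinD -EFinM.
    by rewrite subr0 mulr1 mul0r mul1r.
  pose F (u : R) : R := (u + sin (c + theta * u) / theta).
  have dF (u : R) : is_derive u 1 F (1 + cos (c + theta * u)).
    rewrite /F; apply: is_derive_eq.
    by rewrite scaler0 !add0r mul1r /GRing.scale/= mulr1 mulrCA mulVf// mulr1.
  have cF (u : R) : {for u, continuous F}.
    by apply/differentiable_continuous/derivable1_diffP; apply: ex_derive.
  rewrite (@continuous_FTC2 _ _ F)//.
  - rewrite /F -EFinB; congr (_%:E).
    have -> : c + theta * 1 = (c + theta / 2) + theta / 2 by field.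
    have -> : c + theta * 0 = (c + theta / 2) - theta / 2 by field.
    by rewrite sinD sinB; field.
  - apply: continuous_subspaceT => u; apply: cvgD; first exact: cvg_cst.
    apply: continuous_comp; last exact: continuous_cos.
    by apply: cvgD; [exact: cvg_cst|apply: cvgMr; exact: cvg_id].
  - split => [u _||]; first exact: ex_derive.
    + by apply: cvg_at_right_filter; exact: cF.
    + by apply: cvg_at_left_filter; exact: cF.
  - by move=> u _; rewrite derive1E; apply: derive_val.
have := shifted; under eq_integral do rewrite EFinD.
rewrite integralD//; last 2 first.
- exact: finite_measure_integrable_cst.
- exact: integrable_cos_comp.
rewrite integral_cst_probability EFinD.
by move=> /(congr1 (fun z => z - 1%:E)%E); rewrite ![(1 + _)%E]addeC !addeK.
Qed.

(** The phase [- theta / 2] turns the right-hand cosine of [uniform_cos] into 1, so the factor is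
    the mean of a cosine. *)
Lemma uniform_decay_le1 (theta : R) : `|uniform_decay theta| <= 1.
Proof.
have := uniform_cos (- (theta / 2)) theta.
rewrite addNr cos0 mulr1 => H.
rewrite -lee_fin -abse_EFin -H.
apply: le_trans (le_abse_integral _ _ _) _ => //.
  apply/measurable_EFinP/measurable_cos_comp.
  by apply: measurable_funD => //; apply: measurable_funM => //; exact: measurable_clamp01.
apply: le_trans (ge0_le_integral (f2 := cst 1%E) _ _ _ _ _ _) _ => //.
- apply: measurableT_comp => //; apply/measurable_EFinP/measurable_cos_comp.
  by apply: measurable_funD => //; apply: measurable_funM => //; exact: measurable_clamp01.
- by move=> u _; rewrite abse_EFin lee_fin cos_max.
- by rewrite integral_cst_probability.
Qed.

Lemma uniform_decay_mul_le2 (theta : R) : `|uniform_decay theta| * `|theta| <= 2.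
Proof.
rewrite /uniform_decay; case: eqP => [->|/eqP t0]; first by rewrite normr0 mulr0.
rewrite -normrM divfK// normrM ger0_norm// -[leRHS]mulr1 ler_pM2l//.
exact: sin_max.
Qed.

Lemma measurable_lincomb d (T : measurableType d) (theta : nat -> R)
    (t : nat -> T -> R) (D : nat) :
  (forall i, measurable_fun setT (t i)) ->
  measurable_fun setT (fun w => \sum_(0 <= i < D) theta i * t i w).
Proof.
move=> mt; elim: D => [|D IHD].
  by under eq_fun do rewrite big_geq//; exact: measurable_cst.
under eq_fun do rewrite big_nat_recr//=.
by apply: measurable_funD => //; exact: measurable_funM.
Qed.

(** Independence is recorded only through the mean of a cosine, the one consequence that the
    energies need. The free phase [c] carries the induction: integrating out the last coefficient
    yields a decay factor and shifts the phase by [theta D / 2]. *)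
Lemma iid_uniform (D : nat) : exists (d : measure_display) (T : measurableType d)
    (P : probability T R) (t : nat -> T -> R),
  [/\ forall i, measurable_fun setT (t i), forall i w, 0 <= t i w <= 1 &
   forall (theta : nat -> R) (c : R),
    (\int[P]_w (cos (c + \sum_(0 <= i < D) theta i * t i w))%:E =
    (\prod_(0 <= i < D) uniform_decay (theta i) *
      cos (c + \sum_(0 <= i < D) theta i / 2))%:E)%E].
Proof.
elim: D => [|D [d [T [P [t [mt t01 IH]]]]]].
  exists _, _, (uniform_prob (@ltr01 R)), (fun=> clamp01); split.
  - by move=> _; exact: measurable_clamp01.
  - by move=> _; exact: clamp01_itv.
  - move=> theta c; under eq_integral do rewrite big_geq//.
    by rewrite !big_geq// mul1r integral_cst_probability.
pose t' i (z : T * R) := if i == D then clamp01 z.2 else t i z.1.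
have mt' i : measurable_fun setT (t' i).
  rewrite /t'; case: eqP => _.
    exact: (measurableT_comp measurable_clamp01 measurable_snd).
  exact: (measurableT_comp (mt i) measurable_fst).
exists _, _, (P \x uniform_prob (@ltr01 R))%E, t'; split => //.
  by move=> i z; rewrite /t'; case: eqP => _ //; exact: clamp01_itv.
move=> theta c.
rewrite -integral12_prod_meas1; last first.
  apply: integrable_cos_comp; apply: measurable_funD => //.
  exact: measurable_lincomb.
have sumE w u : \sum_(0 <= i < D.+1) theta i * t' i (w, u) =
    \sum_(0 <= i < D) theta i * t i w + theta D * clamp01 u.
  rewrite big_nat_recr//= /t' eqxx; congr (_ + _).
  by apply: eq_big_nat => i /andP[_ iD]; rewrite ltn_eqF.
rewrite /fubini_F; under eq_integral => w _.
  under eq_integral do rewrite sumE addrA.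
  rewrite uniform_cos mulrC EFinM addrAC; over.
rewrite /= integralZr//; last first.
  apply: integrable_cos_comp; apply: measurable_funD => //.
  exact: measurable_lincomb.
rewrite IH -EFinM; congr (_%:E).
by rewrite !big_nat_recr//= mulrAC addrA (addrAC c).
Qed.

End UniformCoefficients.

(** * Counting with the Fejer kernel *)

Section FejerCount.
Variable R : realType.
Implicit Types (z : nat -> R) (y : R) (N J d : nat).

(** The squared modulus of the sum of [exp (i d z_k)], expanded into pairs because the expectation
    is computed pair by pair. *)
Definition pair_cos (N : nat) (z : nat -> R) (d : nat) : R :=
  \sum_(0 <= k < N) \sum_(0 <= l < N) cos (d%:R * (z k - z l)).

(** The quotient [sin x / x] is [uniform_decay (2 * x)]. *)
Lemma sin_norm_le (x : R) : `|sin x| <= `|x|.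
Proof.
have [->|x0] := eqVneq x 0; first by rewrite sin0 !normr0.
have := uniform_decay_le1 (2 * x).
have x20 : 2 * x != 0 by rewrite mulf_neq0 ?pnatr_eq0.
rewrite /uniform_decay (negbTE x20) (_ : 2 * x / 2 = x); last by field.
by rewrite -mulf_div divff ?pnatr_eq0// mul1r normrM normfV ler_pdivrMr ?normr_gt0// mul1r.
Qed.

Lemma cos_ge_half (x : R) : `|x| <= 1 -> 1 / 2 <= cos x.
Proof.
move=> x1; have -> : x = (x / 2) *+ 2 by rewrite -mulr_natr; field.
rewrite cos_mulr2n cos2sin2.
have : sin (x / 2) ^+ 2 <= (1 / 2) ^+ 2.
  rewrite -real_normK ?num_real// lerXn2r ?nnegrE// ?divr_ge0//.
  by rewrite (le_trans (sin_norm_le _))// normrM (ger0_norm (x := 2^-1))// ler_pM2r.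
by rewrite -mulr_natr; lra.
Qed.

Lemma pair_cosE N z d : pair_cos N z d =
  (\sum_(0 <= k < N) cos (d%:R * z k)) ^+ 2 + (\sum_(0 <= k < N) sin (d%:R * z k)) ^+ 2.
Proof.
rewrite !expr2 !big_distrlr -big_split/=; apply: eq_bigr => k _.
by rewrite -big_split/=; apply: eq_bigr => l _; rewrite mulrBr cosB.
Qed.

Lemma pair_cos_ge0 N z d : 0 <= pair_cos N z d.
Proof. by rewrite pair_cosE addr_ge0 ?sqr_ge0. Qed.

(** The left side is the squared real part of the exponential sum rotated by [exp (- i d y)]. Here
    the dependence on the level [y] disappears. *)
Lemma sqr_sum_cos_le N z y d :
  (\sum_(0 <= k < N) cos (d%:R * (z k - y))) ^+ 2 <= pair_cos N z d.
Proof.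
rewrite pair_cosE.
have -> : \sum_(0 <= k < N) cos (d%:R * (z k - y)) =
    (\sum_(0 <= k < N) cos (d%:R * z k)) * cos (d%:R * y) +
    (\sum_(0 <= k < N) sin (d%:R * z k)) * sin (d%:R * y).
  by rewrite !mulr_suml -big_split/=; apply: eq_bigr => k _; rewrite mulrBr cosB.
set C := \sum_(_ <= _ < _) cos _; set S := \sum_(_ <= _ < _) sin _.
have := cos2Dsin2 (d%:R * y); set c := cos _; set s := sin _ => cs.
have : 0 <= (C * s - S * c) ^+ 2 by exact: sqr_ge0.
suff : (C * c + S * s) ^+ 2 + (C * s - S * c) ^+ 2 = (C ^+ 2 + S ^+ 2) * (c ^+ 2 + s ^+ 2).
  by rewrite cs mulr1 => <-; rewrite lerDl.
ring.
Qed.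

(* AM-GM turns the square root of [pair_cos] into an affine bound, whose
   expectation is computable. *)
Definition freq_bound (N : nat) (z : nat -> R) (d : nat) : R :=
  if d == 0 then N%:R else (N%:R / d%:R + d%:R * pair_cos N z d / N%:R) / 2.

(** The two parts of the AM-GM bound balance at [pair_cos = (N / d) ^+ 2], the size expected of a
    random sample. *)
Lemma sum_cos_le N z y d : (0 < N)%N ->
  \sum_(0 <= k < N) cos (d%:R * (z k - y)) <= freq_bound N z d.
Proof.
move=> N0; rewrite /freq_bound; case: eqP => [->|/eqP d0].
  under eq_bigr do rewrite mul0r cos0.
  by rewrite big_const_nat subn0 iter_addr addr0.
have dp : 0 < d%:R :> R by rewrite ltr0n lt0n.
have Np : 0 < N%:R :> R by rewrite ltr0n.
have := sqr_sum_cos_le N z y d; set S := \sum_(_ <= _ < _) _ => H.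
have : 0 <= (N%:R - d%:R * S) ^+ 2 by exact: sqr_ge0.
have : d%:R ^+ 2 * S ^+ 2 <= d%:R ^+ 2 * pair_cos N z d by rewrite ler_pM2l ?exprn_gt0.
set A := pair_cos _ _ _ => H1 H2.
have -> : (N%:R / d%:R + d%:R * A / N%:R) / 2 =
    (N%:R ^+ 2 + d%:R ^+ 2 * A) / (2 * d%:R * N%:R).
  by field; rewrite !gt_eqF.
rewrite ler_pdivlMr ?mulr_gt0//.
have -> : S * (2 * d%:R * N%:R) =
    N%:R ^+ 2 + d%:R ^+ 2 * S ^+ 2 - (N%:R - d%:R * S) ^+ 2 by ring.
by lra.
Qed.

Lemma freq_bound_ge0 N z d : 0 <= freq_bound N z d.
Proof.
rewrite /freq_bound; case: eqP => // _.
by rewrite divr_ge0// addr_ge0 ?divr_ge0 ?mulr_ge0 ?pair_cos_ge0.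
Qed.

(** A given distance to [i] is attained at most twice. This serves for differences of frequencies
    and for differences of sample indices. *)
Lemma sum_distn_le (a : nat -> R) (i J : nat) : (forall d, 0 <= a d) -> (i < J)%N ->
  \sum_(0 <= j < J) a (if (j < i)%N then i - j else j - i)%N <= 2 * \sum_(0 <= d < J) a d.
Proof.
move=> a0 iJ; rewrite (big_cat_nat (n := i))//=; last exact: ltnW.
have mono m : (m <= J)%N -> \sum_(0 <= d < m) a d <= \sum_(0 <= d < J) a d.
  by move=> mJ; rewrite [leRHS](big_cat_nat (n := m))//= lerDl sumr_ge0.
rewrite mulr_natl mulr2n lerD//.
  rewrite (le_trans _ (mono i.+1 iJ))// [leRHS]big_nat_rev/= add0n.
  rewrite big_nat_recr//= [leLHS](_ : _ = \sum_(0 <= d < i) a (i.+1 - d.+1)%N).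
    by rewrite lerDl.
  by apply: eq_big_nat => j /andP[_ ji]; rewrite ji subSS.
rewrite -{1}(add0n i) big_addn (le_trans _ (mono (J - i)%N (leq_subr _ _)))//.
rewrite le_eqVlt; apply/orP; left; apply/eqP.
by apply: eq_bigr => j _; rewrite ltnNge leq_addl/= addnK.
Qed.

(** Each counted point contributes at least [(J / 2) ^+ 2] to the kernel sum, whose expansion is at
    most [2 * J] times the sum of the frequency bounds; the quotient gives the 8. *)
Lemma fejer_count N J z y : (0 < N)%N -> (0 < J)%N ->
  (\sum_(0 <= k < N) (`|z k - y| * J%:R <= 1)%R%:R) * J%:R <=
  8 * \sum_(0 <= d < J) freq_bound N z d.
Proof.
move=> N0 J0; have Jp : 0 < J%:R :> R by rewrite ltr0n.
(* [J] times the Fejer kernel. Where [|x| * J <= 1], each of the [J] cosines in [GE] is at least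
   1/2. *)
pose G (x : R) := \sum_(0 <= i < J) \sum_(0 <= j < J) cos ((i%:R - j%:R) * x).
have GE x : G x = (\sum_(0 <= i < J) cos (i%:R * x)) ^+ 2 + (\sum_(0 <= i < J) sin (i%:R * x)) ^+ 2.
  rewrite /G !expr2 !big_distrlr -big_split/=; apply: eq_bigr => k _.
  by rewrite -big_split/=; apply: eq_bigr => l _; rewrite mulrBl cosB.
have Glow x : (`|x| * J%:R <= 1)%R%:R * (J%:R / 2) ^+ 2 <= G x.
  rewrite GE; case: (lerP (`|x| * J%:R) 1) => /= [xJ|_]; last by rewrite mul0r addr_ge0 ?sqr_ge0.
  rewrite mul1r (@le_trans _ _ ((\sum_(0 <= i < J) cos (i%:R * x)) ^+ 2))//; last first.
    by rewrite lerDl sqr_ge0.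
  have HJ : J%:R / 2 <= \sum_(0 <= i < J) cos (i%:R * x).
    have -> : J%:R / 2 = \sum_(0 <= i < J) (1 / 2 : R).
      by rewrite big_const_nat subn0 iter_addr addr0 -mulr_natr; ring.
    apply: ler_sum_nat => i /andP[_ iJ]; apply: cos_ge_half.
    rewrite normrM ger0_norm// (le_trans _ xJ)// mulrC ler_wpM2l//.
    by rewrite ler_nat ltnW.
  by rewrite lerXn2r ?nnegrE// ?divr_ge0// (le_trans _ HJ)// divr_ge0.
have Gup : \sum_(0 <= k < N) G (z k - y) <= J%:R * (2 * \sum_(0 <= d < J) freq_bound N z d).
  rewrite /G exchange_big/=.
  have -> : J%:R * (2 * \sum_(0 <= d < J) freq_bound N z d) =
      \sum_(0 <= i < J) (2 * \sum_(0 <= d < J) freq_bound N z d).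
    by rewrite big_const_nat subn0 iter_addr addr0 mulr_natl.
  apply: ler_sum_nat => i /andP[_ iJ].
  rewrite exchange_big/= (le_trans _ (sum_distn_le (freq_bound_ge0 N z) iJ))//.
  apply: ler_sum => j _; rewrite (le_trans _ (sum_cos_le z y _ N0))//.
  rewrite le_eqVlt; apply/orP; left; apply/eqP; apply: eq_bigr => k _.
  case: ltnP => ij; rewrite natrB ?(ltnW ij)//.
  by rewrite -cosN -mulNr opprB.
have : (\sum_(0 <= k < N) (`|z k - y| * J%:R <= 1)%R%:R) * (J%:R / 2) ^+ 2 <=
    J%:R * (2 * \sum_(0 <= d < J) freq_bound N z d).
  by apply: le_trans Gup; rewrite mulr_suml; apply: ler_sum => k _.
set c := \sum_(_ <= _ < _) _; set F := \sum_(_ <= _ < _) _ => H.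
rewrite -(ler_pM2l (x := J%:R / 4)) ?divr_gt0//.
have -> : J%:R / 4 * (c * J%:R) = c * (J%:R / 2) ^+ 2 by field.
by have -> : J%:R / 4 * (8 * F) = J%:R * (2 * F) by field.
Qed.

End FejerCount.

(** * Finite-dimensional probes in the space of Lipschitz functions *)

Section LipSpace.
Variable R : realType.
Implicit Types (g h : R -> R).

Lemma lip_bounded g : Lip g -> exists A, forall x, `|g x| <= A.
Proof.
move=> [pg [L gL]]; exists (`|g 0| + L) => x.
have pz (n : nat) y : g (y + n%:R) = g y.
  by elim: n => [|n IHn]; rewrite ?addr0// -natr1 addrA pg.
have pzi (i : int) y : g (y + i%:~R) = g y.
  case: i => n; first exact: pz.
  by rewrite NegzE mulrNz -[in RHS](subrK n.+1%:R y) pz.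
have L0 : 0 <= L by have := gL 1 0; rewrite subr0 normr1 mulr1; apply: le_trans.
have -> : g x = g (x - (Num.floor x)%:~R).
  by rewrite -[in LHS](subrK (Num.floor x)%:~R x) pzi.
have /andP[x0 x1] := floor_itv x; rewrite intrD in x1.
set u := x - _; have u01 : `|u| <= 1 by rewrite /u ler_norml; lra.
rewrite -[in leLHS](subrK (g 0) (g u)) (le_trans (ler_normD _ _))// addrC lerD2l.
by rewrite (le_trans (gL _ _))// subr0 ler_piMr.
Qed.

Lemma lip_seminorm_ge0 g : 0 <= lip_seminorm g.
Proof.
rewrite /lip_seminorm; set S := [set _ | _].
(* A set without a supremum has [sup] equal to 0, so [g] may be arbitrary. *)
have [hs|/sup_out->//] := pselect (has_sup S).
have [r Sr] := hs.1; apply: le_trans (ub_le_sup hs.2 Sr).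
by case: Sr => x [y [_ ->]]; rewrite divr_ge0.
Qed.

Lemma norm_le_lip_norm g x : Lip g -> `|g x| <= lip_norm g.
Proof.
move=> /lip_bounded[A gA]; rewrite /lip_norm.
apply: (@le_trans _ _ (sup_norm g)); last by rewrite lerDl lip_seminorm_ge0.
by apply: ub_le_sup; [exists A => _ [z _ <-]|exists x].
Qed.

Lemma lip_norm_le g (A L : R) : (forall x, `|g x| <= A) ->
  (forall x y, `|g x - g y| <= L * `|x - y|) -> lip_norm g <= A + L.
Proof.
move=> gA gL; apply: lerD; apply: ge_sup.
- by exists `|g 0|; exists 0.
- by move=> _ [x _ <-].
- by exists (`|g 1 - g 0| / `|1 - 0|); exists 1, 0; rewrite oner_neq0.
- by move=> _ [x [y [xy ->]]]; rewrite ler_pdivrMr// normr_gt0 subr_eq0.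
Qed.

Lemma Lip_sub g h : Lip g -> Lip h -> Lip (g \- h).
Proof.
move=> [pg [L gL]] [ph [M hM]]; split => [x|]; first by rewrite /= pg ph.
exists (L + M) => x y /=; rewrite mulrDl.
have -> : g x - h x - (g y - h y) = (g x - g y) - (h x - h y) by ring.
by rewrite (le_trans (ler_normB _ _))// lerD.
Qed.

Lemma Lip_opp g : Lip g -> Lip (fun x => - g x).
Proof.
move=> [pg [L gL]]; split => [x|]; first by rewrite pg.
by exists L => x y; rewrite -opprD normrN.
Qed.

End LipSpace.

Section Probe.
Variables (R : realType) (D : nat) (phi : nat -> R -> R).
Hypotheses (phi_periodic : forall i, periodic1 (phi i))
  (phi_le1 : forall i x, `|phi i x| <= 1)
  (phi_lip : forall i x y, `|phi i x - phi i y| <= `|x - y|).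

Definition comb (v : nat -> R) (s : R) : R := \sum_(0 <= i < D) v i * phi i s.

Lemma comb_bound (v : nat -> R) (e s : R) : (forall i, (i < D)%N -> `|v i| <= e) ->
  `|comb v s| <= D%:R * e.
Proof.
move=> ve; rewrite (le_trans (ler_norm_sum _ _ _))//.
have -> : D%:R * e = \sum_(0 <= i < D) e.
  by rewrite big_const_nat subn0 iter_addr addr0 mulr_natl.
apply: ler_sum_nat => i /andP[_ iD]; rewrite normrM -[leRHS]mulr1.
by rewrite ler_pM// ve.
Qed.

Lemma comb_lipschitz (v : nat -> R) (e x y : R) : (forall i, (i < D)%N -> `|v i| <= e) ->
  `|comb v x - comb v y| <= D%:R * e * `|x - y|.
Proof.
move=> ve; rewrite /comb -sumrB (le_trans (ler_norm_sum _ _ _))//.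
have -> : D%:R * e * `|x - y| = \sum_(0 <= i < D) e * `|x - y|.
  by rewrite big_const_nat subn0 iter_addr addr0 -mulrA mulr_natl.
apply: ler_sum_nat => i /andP[_ iD]; rewrite -mulrBr normrM.
by rewrite ler_pM// ve.
Qed.

Lemma Lip_comb v : Lip (comb v).
Proof.
split=> [x|]; first by apply: eq_bigr => i _; rewrite phi_periodic.
exists (D%:R * \sum_(0 <= i < D) `|v i|) => x y; apply: comb_lipschitz => i iD.
rewrite (bigD1_seq i) ?mem_index_iota ?iota_uniq//=.
by rewrite lerDl sumr_ge0.
Qed.

Lemma combB v v' s : comb v s - comb v' s = comb (fun i => v i - v' i) s.
Proof. by rewrite /comb -sumrB; apply: eq_bigr => i _; rewrite mulrBl. Qed.

Lemma comb_open (x : R -> R) (U : set (R -> R)) (v : nat -> R) :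
  Lip x -> lip_open U -> U (comb v \- x) ->
  exists2 e : R, 0 < e & forall v', (forall i, (i < D)%N -> `|v' i - v i| <= e) ->
    U (comb v' \- x).
Proof.
move=> Lx [_ oU] /oU[e [e0 He]].
(* Sup norm and Lipschitz constant of the difference each cost [D] times the coefficient error;
   [D.+1] keeps the total strictly below [e] and also covers [D = 0]. *)
exists (e / (2 * D.+1%:R)); first by rewrite divr_gt0// mulr_gt0.
move=> v' vv'; apply: He; first by apply: Lip_sub => //; exact: Lip_comb.
have -> : (comb v' \- x) \- (comb v \- x) = comb (fun i => v' i - v i).
  by apply/funext => s /=; rewrite -combB; ring.
apply: le_lt_trans (lip_norm_le _ _) _.
- by move=> s; exact: comb_bound vv'.
- by move=> s t; exact: comb_lipschitz vv'.
- set n : R := D.+1%:R; have n0 : 0 < n by rewrite ltr0n.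
  have -> : D%:R * (e / (2 * n)) + D%:R * (e / (2 * n)) = e * (D%:R / n).
    by field; rewrite gt_eqF.
  by rewrite gtr_pMr// ltr_pdivrMr// mul1r ltr_nat.
Qed.

Section Measurability.
Variables (d : measure_display) (T : measurableType d) (t : nat -> T -> R).
Hypothesis mt : forall i, measurable_fun setT (t i).

Definition random_comb (w : T) : R -> R := comb (t ^~ w).

(** Only [D] real coordinates matter, so the preimage is a countable union of boxes with rational
    centres; no separability of the Lipschitz space enters. *)
Lemma measurable_preimage_open (x : R -> R) (U : set (R -> R)) : Lip x ->
  lip_open U -> measurable [set w | U (random_comb w \- x)].
Proof.
move=> Lx oU.
pose near_rat (p : seq rat * nat) (v : nat -> R) :=
  forall i, (i < D)%N -> `|v i - ratr p.1`_i| < p.2.+1%:R^-1.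
pose good p := forall v, near_rat p v -> U (comb v \- x).
pose box k : set T := if unpickle k is Some p then
  [set w | good p /\ near_rat p (t ^~ w)] else set0.
have -> : [set w | U (random_comb w \- x)] = \bigcup_k box k.
  apply/seteqP; split => [w /= Uw|w [k _]]; last first.
    by rewrite /box; case: unpickle => [p [gp np]|//]; exact: gp.
  have [e e0 He] := comb_open Lx oU Uw.
  have [n ne] : exists n : nat, n.+1%:R^-1 + n.+1%:R^-1 <= e.
    exists (Num.trunc (2 / e)); rewrite -mulr2n -[leLHS]mulr_natl.
    rewrite ler_pdivrMr// -ler_pdivrMl// mulrC.
    by rewrite ltW// truncnS_gt.
  have ratnear i : exists q : rat, `|t i w - ratr q| < n.+1%:R^-1.
    set a : R := n.+1%:R^-1; have a0 : 0 < a by rewrite invr_gt0.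
    have [|q] := @rat_in_itvoo R (t i w - a) (t i w + a); first by lra.
    by rewrite in_itv/= => /andP[? ?]; exists q; rewrite ltr_norml; apply/andP; split; lra.
  have [q Hq] := choice ratnear.
  pose p : seq rat * nat := (mkseq q D, n).
  exists (pickle p) => //; rewrite /box pickleK; split.
    move=> v vp; apply: He => i iD.
    have := vp i iD; rewrite /= nth_mkseq// => vi.
    have := Hq i; move: vi ne; set a : R := n.+1%:R^-1; set c : R := ratr _.
    by rewrite !ltr_norml ler_norml => /andP[? ?] ? /andP[? ?]; apply/andP; split; lra.
  by move=> i iD; rewrite /= nth_mkseq.
apply: bigcupT_measurable => k; rewrite /box; case: unpickle => [p|//].
have [gp|ngp] := pselect (good p); last first.
  by rewrite (_ : [set _ | _] = set0)//; apply/seteqP; split => w [].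
have -> : [set w | good p /\ near_rat p (t ^~ w)] =
    \bigcap_(i in `I_D) [set w | `|t i w - ratr p.1`_i| < p.2.+1%:R^-1].
  by apply/seteqP; split => w /=; [move=> [_ H] i /H|move=> H; split=> // i iD; exact: H].
apply: bigcap_measurableType => i iD.
rewrite -[X in measurable X]setTI; apply: measurable_fun_ltr => //.
by apply: measurableT_comp => //; exact: measurable_funB.
Qed.

(** Sets with measurable preimage form a sigma-algebra. Complements are relative to [Lip], hence the
    appeal to [Lip_sub] and [Lip_comb]. *)
Lemma measurable_preimage_borel (x : R -> R) (B : set (R -> R)) : Lip x ->
  lip_borel B -> measurable [set w | B (random_comb w \- x)].
Proof.
move=> Lx.
suff : lip_borel (R := R) `<=` [set B | measurable [set w | B (random_comb w \- x)]] by apply.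
apply: smallest_sub; last by move=> U oU; exact: measurable_preimage_open.
split => /= [|A mA|F mF].
- by rewrite (_ : [set _ | _] = set0).
- rewrite (_ : [set _ | _] = ~` [set w | A (random_comb w \- x)]); first exact: measurableC.
  apply/seteqP; split => w /=; first by case.
  by move=> nA; split => //; apply: Lip_sub => //; exact: Lip_comb.
- rewrite (_ : [set _ | _] = \bigcup_n [set w | F n (random_comb w \- x)]) //.
  exact: bigcupT_measurable.
Qed.

Definition probe_measure (P : probability T R) (A : set (R -> R)) : \bar R :=
  P [set w | A (random_comb w)].

Lemma preimage_translate (x : R -> R) (B : set (R -> R)) :
  [set w | translate x B (random_comb w)] = [set w | B (random_comb w \- x)].
Proof.
apply/seteqP; split => w /=.
  by move=> [h Bh <-]; rewrite (_ : (x \+ h) \- x = h)//; apply/funext => s /=; rewrite addrC addKr.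
by move=> Bw; exists (random_comb w \- x) => //; apply/funext => s /=; rewrite addrC subrK.
Qed.

Lemma probe_measure_borel (P : probability T R) : lip_borel_measure (probe_measure P).
Proof.
have mB B : lip_borel B -> measurable [set w | B (random_comb w)].
  move=> bB; have := @measurable_preimage_borel (fun=> 0) B.
  rewrite (_ : [set _ | _] = [set w | B (random_comb w)]).
    by apply => //; split=> //; exists 0 => *; rewrite subrr normr0 mul0r.
  have sub0 w : random_comb w \- (fun=> 0) = random_comb w.
    by apply/funext => s /=; rewrite subr0.
  by apply/seteqP; split => w /=; rewrite sub0.
rewrite /probe_measure; split; [|split].
- by rewrite (_ : [set _ | _] = set0) ?measure0.
- by move=> A bA; rewrite measure_ge0.
- move=> F bF tF.
  have -> : [set w | (\bigcup_n F n) (random_comb w)] =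
      \bigcup_n [set w | F n (random_comb w)] by [].
  apply: measure_semi_sigma_additive.
  + by move=> n; exact: mB.
  + by move=> i j _ _ [w [Fi Fj]]; apply: (tF i j) => //; exists (random_comb w).
  + by apply: bigcupT_measurable => n; exact: mB.
Qed.

End Measurability.

Definition probe_cube : set (R -> R) := [set comb v | v in [set v | forall i, 0 <= v i <= 1]].

Lemma probe_cube_compact : lip_compact probe_cube.
Proof.
split=> [_ [v _ <-]|I U oU cU]; first exact: Lip_comb.
(* The extra coordinate makes the index type nonempty, as [inord] requires; [comb] ignores it. *)
pose cf (u : 'rV[R]_D.+1) (i : nat) : R := u ord0 (inord i).
pose box : set 'rV[R]_D.+1 := [set u | forall i, `[0, 1]%classic (u ord0 i)].
have cbox : compact box.
  exact: (@rV_compact R _ (fun=> `[0, 1]%classic) (fun=> @segment_compact R 0 1)).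
have inU u : box u -> exists i, U i (comb (cf u)).
  move=> bu; have [|i _ Ui] := cU (comb (cf u)); last by exists i.
  by exists (cf u) => // i /=; have := bu (inord i); rewrite /= in_itv.
have [i0 _] : exists i, U i (comb (cf 0)).
  by apply: inU => i; rewrite /= in_itv/= mxE lexx ler01.
(* The cover is re-indexed by parameter vectors, because [I] is a bare type; vectors outside the box
   get the default [i0]. *)
have [f Hf] : {f : 'rV[R]_D.+1 -> I & forall u, box u -> U (f u) (comb (cf u))}.
  apply: (choice (P := fun u i => box u -> U i (comb (cf u)))) => u.
  by have [bu|nbu] := pselect (box u); [have [i Ui] := inU u bu; exists i|exists i0].
have L0 : Lip (fun=> 0 : R) by split=> //; exists 0 => *; rewrite subrr normr0 mul0r.
have comb0 v : comb v \- (fun=> 0) = comb v by apply/funext => s /=; rewrite subr0.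
pose V (u : 'rV[R]_D.+1) : set 'rV[R]_D.+1 := [set u' | U (f u) (comb (cf u'))].
have oV u : open (V u).
  rewrite openE => u' /= Vu'; apply/nbhs_ballP.
  have [|e e0 He] := comb_open (v := cf u') L0 (oU (f u)); first by rewrite comb0.
  exists e => // u'' [_ Bu'']; rewrite /V /= -comb0; apply: He => i iD.
  by have := Bu'' ord0 (inord i); rewrite /ball/= distrC => /ltW.
move: cbox; rewrite compact_cover => /(_ _ box V (fun u _ => oV u)).
case=> [u bu|E Ebox Ecov]; first by exists u => //; exact: Hf.
pose s := finmap.enum_fset E.
exists (size s), (fun j : 'I_(size s) => f (nth 0 s j)) => _ [v v01 <-].
pose u : 'rV[R]_D.+1 := \row_i v i.
have cfu : comb (cf u) = comb v.
  apply/funext => z; apply: eq_big_nat => i /andP[_ iD].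
  by rewrite /cf mxE inordK// ltnS ltnW.
have [|u' /= Eu' Vu'] := Ecov u; first by move=> i; rewrite /= in_itv/= mxE.
have iE : (index u' s < size s)%N by rewrite index_mem.
by exists (Ordinal iE) => /=; rewrite nth_index//; move: Vu'; rewrite /V /= cfu.
Qed.

End Probe.

(** * Box counting *)

Section MinkowskiDimension.
Variables (R : realType) (b : nat).
Hypothesis b_ge2 : (2 <= b)%N.

Definition cell_meets (E : set R) (N k : nat) : Prop :=
  exists x, E x /\ k%:R / N%:R <= x < k.+1%:R / N%:R.

Definition cell_count (E : set R) (N : nat) : nat :=
  count (fun k => `[< cell_meets E N k >]) (iota 0 N).

Lemma esum1_le_size (S : set int) (s : seq int) : (forall q, S q -> q \in s) ->
  (esum S (fun=> 1%E) <= (size s)%:R%:E :> \bar R)%E.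
Proof.
move=> Ss; apply: ub_ereal_sup => _ [A [finA AS] <-].
rewrite fsbig_finite//= sumEFin lee_fin.
rewrite big_const_seq iter_addr addr0 count_predT ler_nat.
apply: uniq_leq_size; first exact: finmap.fset_uniq.
by move=> q; rewrite in_fset_set// inE => /AS /Ss.
Qed.

(** A cell of width [1 / N <= d] meets at most two consecutive intervals of the mesh [d], those
    numbered [r k] and [r k + 1]. *)
Lemma mesh_count_le (E : set R) (N : nat) (d : R) : (0 < N)%N ->
  (forall x, E x -> 0 <= x < 1) -> N%:R^-1 <= d ->
  (mesh_count d E <= (2 * (cell_count E N)%:R)%:E)%E.
Proof.
move=> N0 E01 Nd; have Np : 0 < N%:R :> R by rewrite ltr0n.
have d0 : 0 < d by rewrite (lt_le_trans _ Nd)// invr_gt0.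
pose r (k : nat) : int := Num.floor (k%:R / N%:R / d).
pose s := flatten [seq [:: r k; r k + 1] | k <- iota 0 N & `[< cell_meets E N k >]].
have -> : (2 * (cell_count E N)%:R : R) = (size s)%:R.
  rewrite size_flatten /shape -map_comp /cell_count -size_filter -natrM; congr (_%:R).
  by elim: [seq _ <- _ | _] => [|k t IHt] //=; rewrite mulnS IHt.
apply: esum1_le_size => q [x [Ex /andP[qx xq]]].
have /andP[x0 x1] := E01 x Ex.
pose k := Num.trunc (x * N%:R).
have /andP[kx xk] : k%:R <= x * N%:R < k.+1%:R by apply: truncn_itv; rewrite mulr_ge0.
have kN : (k < N)%N.
  by rewrite -(ltr_nat R) (le_lt_trans kx)// gtr_pMl.
apply/flattenP; exists [:: r k; r k + 1].
  apply/mapP; exists k => //; rewrite mem_filter mem_iota kN !andbT.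
  by apply/asboolP; exists x; split=> //; rewrite ler_pdivrMr// ltr_pdivlMr// kx.
have /andP[r0 r1] := floor_itv (k%:R / N%:R / d).
rewrite -/(r k) intrD in r0 r1.
have kNx : k%:R / N%:R <= x by rewrite ler_pdivrMr.
have xkN : x < k%:R / N%:R + d.
  have : x < k.+1%:R / N%:R by rewrite ltr_pdivlMr.
  by rewrite -natr1 mulrDl mul1r => /lt_le_trans; apply; rewrite lerD2l.
move: r0 r1; rewrite ler_pdivlMr// ltr_pdivrMr// => r0 r1.
have : (r k)%:~R * d < (q + 1)%:~R * d.
  by rewrite (le_lt_trans r0)// (le_lt_trans kNx).
rewrite ltr_pM2r// ltr_int ltzD1 => rq.
have : q%:~R * d < (r k + 1 + 1)%:~R * d.
  rewrite (le_lt_trans qx)// (lt_trans xkN)// !intrD mulrDl mul1r ltrD2r//.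
rewrite ltr_pM2r// ltr_int ltzD1 => qr.
rewrite !inE; have [->//|rq'] := eqVneq q (r k).
by rewrite eq_le qr lezD1 lt_neqAle eq_sym rq' rq.
Qed.

Lemma upper_minkowski_dim_le (E : set R) (s C : R) (n0 : nat) :
  (forall x, E x -> 0 <= x < 1) -> 0 <= s -> 1 <= C ->
  (forall n, (n0 <= n)%N ->
    (cell_count E (b ^ n))%:R <= C * (b%:R ^+ n) `^ s * n.+1%:R ^+ 4) ->
  (upper_minkowski_dim E <= s%:E)%E.
Proof.
move=> E01 s0 C1 HC; apply/lee_addgt0Pr => e e0.
have b1 : 1 < b%:R :> R by rewrite ltr1n.
have bp : 0 < b%:R :> R by rewrite (lt_trans _ b1).
pose L : R := ln b%:R; have L0 : 0 < L by rewrite ln_gt0.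
(* By [ln x < x] at [x = delta * m.+2], the polynomial factor uses about half of the allowance
   [e * (m * L)]; [n1] is so large that the other half pays for the constants. *)
pose delta := e * L / 8; have delta0 : 0 < delta by rewrite divr_gt0// mulr_gt0.
pose K := ln (2 * C) - 4 * ln delta.
pose n1 := (maxn n0 2 + Num.trunc ((K + e * L + s * L + e * L) / (e * L / 2)))%N.
have n1_ge0 : (n0 <= n1)%N by exact: leq_trans (leq_maxl _ _) (leq_addr _ _).
have n1_ge2 : (2 <= n1)%N by exact: leq_trans (leq_maxr _ _) (leq_addr _ _).
have eL : 0 < e * L / 2 by rewrite divr_gt0// mulr_gt0.
have growth (m : nat) : (n1 <= m)%N ->
    ln (2 * (C * (b%:R ^+ m.+1) `^ s * m.+2%:R ^+ 4)) <= (s + e) * (m%:R * L).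
  move=> n1m.
  have bm : 0 < b%:R ^+ m.+1 :> R by rewrite exprn_gt0.
  have C0 : 0 < C by rewrite (lt_le_trans _ C1).
  have m2 : 0 < m.+2%:R :> R by rewrite ltr0n.
  have lnE : ln (2 * (C * (b%:R ^+ m.+1) `^ s * m.+2%:R ^+ 4)) =
      ln (2 * C) + s * (m.+1%:R * L) + 4 * ln m.+2%:R.
    have lnM_pos (x y : R) : 0 < x -> 0 < y -> ln (x * y) = ln x + ln y.
      by move=> *; rewrite lnM ?posrE.
    have p1 : 0 < 2 * C by rewrite mulr_gt0.
    have p2 : 0 < (b%:R ^+ m.+1) `^ s by rewrite powR_gt0.
    rewrite 2!mulrA (lnM_pos _ _ (mulr_gt0 p1 p2)) ?exprn_gt0// (lnM_pos _ _ p1 p2).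
    by rewrite ln_powR (lnXn _ bp) (lnXn _ m2) -(mulr_natl (ln b%:R)) -(mulr_natl (ln m.+2%:R)).
  rewrite lnE.
  have lnm : ln m.+2%:R <= delta * m.+2%:R - ln delta.
    rewrite lerBrDr addrC -lnM ?posrE// ltW// ln_sublinear// mulr_gt0//.
  have mbig : K + e * L + s * L + e * L <= m%:R * (e * L / 2).
    rewrite -ler_pdivrMr// ltW// (lt_le_trans (truncnS_gt _))// ler_nat.
    by apply: leq_trans n1m; rewrite -add1n leq_add2r (leq_trans _ (leq_maxr _ _)).
  move: lnm mbig; rewrite /K -(natr1 m.+1) -(natr1 m); set M : R := m%:R => lnm mbig.
  have deltaE : 4 * (delta * (M + 1 + 1)) = e * L / 2 * (M + 1 + 1).
    by rewrite /delta; field.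
  have eL1 : 0 < e * L by rewrite mulr_gt0.
  by clear -deltaE lnm mbig eL1; lra.
pose eta : R := (b%:R ^+ n1)^-1.
have eta01 : 0 < eta < 1.
  rewrite invr_gt0 exprn_gt0//= invf_lt1 ?exprn_gt0// exprn_egt1//.
  by rewrite -lt0n (leq_trans _ n1_ge2).
apply: (@le_trans _ _ (ereal_sup [set box_ratio d E | d in [set d : R | 0 < d < eta]])).
  by apply: ereal_inf_lbound; exists eta.
apply: ub_ereal_sup => _ [d /= /andP[d0 deta] <-].
have [|m [md md1]] := scale_of_distance (d := d) b_ge2.
  by rewrite d0/= ltW// (lt_trans deta)//; case/andP: eta01.
have n1m : (n1 <= m)%N.
  rewrite -ltnS -(ltr_eXn2l (x := b%:R : R))//.
  have : b%:R ^+ n1 * d < 1 by rewrite mulrC -ltr_pdivlMr ?exprn_gt0// mul1r.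
  by move=> /lt_trans /(_ md1); rewrite ltr_pM2r.
set Y := C * (b%:R ^+ m.+1) `^ s * m.+2%:R ^+ 4.
have cntY : (cell_count E (b ^ m.+1))%:R <= Y.
  by apply: HC; rewrite (leq_trans n1_ge0)// (leq_trans n1m).
have Y1 : 1 <= Y.
  rewrite /Y -[leLHS]mulr1 ler_pM//; last by rewrite exprn_ege1// ler1n.
  rewrite -[leLHS]mulr1 ler_pM//.
  by rewrite -[leLHS](powRr0 (b%:R ^+ m.+1)) ler_powR// exprn_ege1// ltW.
have lnd : m%:R * L <= - ln d.
  rewrite lerNr .
  have : ln d <= ln (b%:R ^+ m)^-1.
    rewrite ler_ln ?posrE ?invr_gt0 ?exprn_gt0//.
    by rewrite -[leRHS]mul1r ler_pdivlMr ?exprn_gt0// mulrC.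
  by rewrite lnV ?posrE ?exprn_gt0// (lnXn _ bp) -(mulr_natl (ln b%:R)).
have mL0 : 0 < m%:R * L by rewrite mulr_gt0// ltr0n (leq_trans _ n1m)// (leq_trans _ n1_ge2).
have : (mesh_count d E <= (2 * Y)%:E)%E.
  apply: le_trans (mesh_count_le (N := (b ^ m.+1)%N) _ E01 _) _.
  - by rewrite expn_gt0 ltnW.
  - rewrite natrX -[leLHS]mul1r ler_pdivrMr ?exprn_gt0// mulrC.
    exact: ltW.
  - by rewrite lee_fin ler_pM2l.
have : (0 <= mesh_count d E)%E by apply: esum_ge0.
rewrite /box_ratio; case: (mesh_count d E) => [r| |]//.
rewrite !lee_fin => r0 rY.
have lnr : ln r <= (s + e) * (m%:R * L).
  apply: le_trans (growth m n1m); rewrite -/Y.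
  (* An empty set has count 0 and [ln 0 = 0]; the right side is nonnegative since [Y >= 1]. *)
  have [rp|rn] := ltP 0 r; last first.
    by rewrite ln0// ln_ge0//; lra.
  by rewrite ler_ln ?posrE//; lra.
rewrite ler_pdivrMr; last by rewrite (lt_le_trans mL0).
rewrite (le_trans lnr)// ler_pM2l//.
by rewrite ltr_wpDl.
Qed.

End MinkowskiDimension.

(** * Energies *)

Section EnergyContinuity.
Variable R : realType.

Lemma cos_lipschitz (u v : R) : `|cos u - cos v| <= `|u - v|.
Proof.
have -> : cos u - cos v = - 2 * (sin ((u + v) / 2) * sin ((u - v) / 2)).
  have key (p q : R) : cos (p + q) - cos (p - q) = - 2 * (sin p * sin q).
    by rewrite cosD cosB; ring.
  by rewrite -key; congr (cos _ - cos _); field.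
rewrite normrM normrN (ger0_norm (x := 2))// normrM.
have s1 := sin_max ((u + v) / 2); have s2 := sin_norm_le ((u - v) / 2).
have -> : `|u - v| = 2 * (1 * `|(u - v) / 2|).
  by rewrite normrM (ger0_norm (x := 2^-1))//; field.
by rewrite ler_pM2l// ler_pM.
Qed.

Lemma pair_cos_dist_le (N : nat) (z z' : nat -> R) (d : nat) (e : R) :
  (forall k, (k < N)%N -> `|z k - z' k| <= e) ->
  `|pair_cos N z d - pair_cos N z' d| <= N%:R ^+ 2 * (2 * d%:R * e).
Proof.
move=> ze; rewrite /pair_cos -sumrB (le_trans (ler_norm_sum _ _ _))//.
have sumc (c : R) : \sum_(0 <= k < N) c = N%:R * c.
  by rewrite big_const_nat subn0 iter_addr addr0 mulr_natl.
rewrite expr2 -mulrA -sumc; apply: ler_sum_nat => k /andP[_ kN].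
rewrite -sumrB (le_trans (ler_norm_sum _ _ _))// -sumc.
apply: ler_sum_nat => l /andP[_ lN].
rewrite (le_trans (cos_lipschitz _ _))// -mulrBr normrM ger0_norm//.
rewrite mulrAC mulrC ler_wpM2r//.
have -> : z k - z l - (z' k - z' l) = (z k - z' k) - (z l - z' l) by ring.
by rewrite (le_trans (ler_normB _ _))// mulr_natl mulr2n lerD// ze.
Qed.

End EnergyContinuity.

Section Harmonic.
Variables (R : realType) (b : nat).
Hypothesis b_gt0 : (0 < b)%N.

(** Each block from [b ^ n] to [b ^ n.+1] contributes at most [b]. The crude constant is harmless,
    since powers of [n] are lost anyway. *)
Lemma harmonic_le (n J : nat) : (J <= b ^ n)%N ->
  \sum_(1 <= d < J) d%:R^-1 <= n%:R * b%:R :> R.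
Proof.
elim: n J => [|n IHn] J JN.
  by rewrite big_geq ?mul0r//; rewrite expn0 in JN.
have [JbN|bNJ] := leqP J (b ^ n).
  by rewrite (le_trans (IHn _ JbN))// ler_wpM2r// ler_nat.
have bn0 : (0 < b ^ n)%N by rewrite expn_gt0 b_gt0.
rewrite (big_cat_nat (n := (b ^ n)%N))//=; last exact: ltnW.
rewrite -natr1 mulrDl mul1r lerD ?IHn//.
apply: (@le_trans _ _ (\sum_(b ^ n <= d < J) ((b ^ n)%:R^-1 : R))).
  apply: ler_sum_nat => d /andP[nd dJ].
  by rewrite lef_pV2 ?posrE ?ltr0n ?ler_nat// (leq_trans bn0).
rewrite big_const_nat iter_addr addr0 -[_ *+ _]mulr_natl ler_pdivrMr ?ltr0n//.
by rewrite -natrM ler_nat (leq_trans (leq_subr _ _))// -expnS.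
Qed.

End Harmonic.

(** * Linear and continuous dependence of the Weierstrass function on [g] *)

Section WeierstrassLinear.
Variables (R : realType) (b : nat) (alpha : R).
Hypotheses (b_ge2 : (2 <= b)%N) (alpha_gt0 : 0 < alpha) (alpha_lt : alpha < 1 / 2).
Local Notation beta := ((b%:R : R) `^ (- alpha)).
Local Notation W := (weierstrass alpha b).

Lemma weierstrassB (g h : R -> R) (x : R) : Lip g -> Lip h ->
  W (g \- h) x = W g x - W h x.
Proof.
move=> /lip_bounded[A gA] Lh; have [A' hA] := lip_bounded Lh.
have [A'' hA'] := lip_bounded (Lip_opp Lh).
have -> : g \- h = g \+ (fun x => - h x) by [].
rewrite (weierstrassD b_ge2 alpha_gt0 alpha_lt x gA hA'); congr (_ + _).
have -> : (fun x => - h x) = (fun x => -1 * h x) by apply/funext => z; rewrite mulN1r.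
by rewrite (weierstrassZ b_ge2 alpha_gt0 alpha_lt _ _ hA) mulN1r.
Qed.

Lemma weierstrass_comb (D : nat) (phi : nat -> R -> R) (v : nat -> R) (x : R) :
  (forall i y, `|phi i y| <= 1) ->
  W (comb D phi v) x = \sum_(0 <= i < D) v i * W (phi i) x.
Proof.
move=> phi1; elim: D => [|D IHD].
  have -> : comb 0 phi v = (fun y => 0 * phi 0%N y).
    by apply/funext => y; rewrite /comb big_geq// mul0r.
  by rewrite (weierstrassZ b_ge2 alpha_gt0 alpha_lt _ _ (phi1 0%N)) mul0r big_geq.
have -> : comb D.+1 phi v = comb D phi v \+ (fun y => v D * phi D y).
  by apply/funext => y; rewrite /comb big_nat_recr.
rewrite big_nat_recr//= -IHD.
have cb y : `|comb D phi v y| <= D%:R * \sum_(0 <= i < D) `|v i|.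
  apply: comb_bound => // i iD.
  by rewrite (bigD1_seq i) ?mem_index_iota ?iota_uniq//= lerDl sumr_ge0.
have pb y : `|v D * phi D y| <= `|v D| by rewrite normrM ler_piMr.
rewrite (weierstrassD b_ge2 alpha_gt0 alpha_lt x cb pb); congr (_ + _).
by rewrite (weierstrassZ b_ge2 alpha_gt0 alpha_lt _ _ (phi1 D)).
Qed.

Lemma weierstrass_lip_norm (g h : R -> R) (x : R) : Lip g -> Lip h ->
  `|W g x - W h x| <= lip_norm (g \- h) / (1 - beta).
Proof.
move=> Lg Lh; rewrite -weierstrassB//.
apply: (weierstrass_bound b_ge2 alpha_gt0 alpha_lt) => z.
by apply: norm_le_lip_norm; exact: Lip_sub.
Qed.

Lemma exists_depth (c : R) : exists J0, c <= (beta ^+ J0)^-1.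
Proof.
have b0 := ratio_gt0 b_ge2 alpha_gt0 alpha_lt; have b1 := ratio_lt1 b_ge2 alpha_gt0.
have [c0|c0] := leP c 0; first by exists 0; rewrite (le_trans c0)// invr_ge0 exprn_ge0// ltW.
have /cvgrPdist_lt : beta ^+ n @[n --> \oo] --> 0 by apply: cvg_expr; rewrite gtr0_norm.
move=> /(_ c^-1); rewrite invr_gt0 => /(_ c0)[n _ /(_ n (leqnn n))] /=.
rewrite sub0r normrN gtr0_norm ?exprn_gt0// => H.
by exists n; rewrite -[leLHS]invrK lef_pV2 ?posrE ?invr_gt0 ?exprn_gt0// ltW.
Qed.

End WeierstrassLinear.

(** * From energies to cell counts *)

Section Energy.
Variables (R : realType) (b : nat) (alpha : R).
Hypotheses (b_ge2 : (2 <= b)%N) (alpha_gt0 : 0 < alpha) (alpha_lt : alpha < 1 / 2).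
Local Notation beta := ((b%:R : R) `^ (- alpha)).
Local Notation W := (weierstrass alpha b).
Variable J0 : nat.

Let b_gt0 : (0 < b)%N. Proof. exact: ltnW. Qed.
Let base_gt0 : 0 < b%:R :> R. Proof. by rewrite ltr0n. Qed.

(* The circle is cut into b ^ J0 arcs because [probe_separates] only handles
   pairs at distance at most b ^ - J0. *)
Definition grid (v a k : nat) : R := (a * b ^ v + k)%:R / (b ^ (J0 + v))%:R.

(** The cut-off [b ^ (alpha n)] for [n = J0 + v]: its inverse matches the oscillation [beta ^+ n] of
    a normalized sample over one cell. *)
Definition freqs (v : nat) : nat := Num.trunc ((beta ^+ (J0 + v))^-1).

(** Division by [M.+1] normalizes the Hoelder constant, so that the cut-off frequency does not
    depend on [g]. *)
Definition sample (g : R -> R) (M v a k : nat) : R := W g (grid v a k) / M.+1%:R.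

Definition energy (g : R -> R) (M v : nat) : R :=
  \sum_(0 <= a < b ^ J0) \sum_(1 <= d < freqs v)
    d%:R * pair_cos (b ^ v) (sample g M v a) d.

(** Two powers of [v.+1] absorb the logarithms of the expected energy, the other two make the Markov
    bounds summable in [v]. *)
Definition energy_scale (v : nat) : R := (b ^ v)%:R ^+ 2 * v.+1%:R ^+ 4.

Lemma freqs_le v : (freqs v)%:R <= (beta ^+ (J0 + v))^-1.
Proof.
by rewrite truncn_le// invr_ge0 exprn_ge0// ltW// ratio_gt0.
Qed.

Lemma freqs_ge v : (beta ^+ (J0 + v))^-1 <= 2 * (freqs v)%:R.
Proof.
have b0 := ratio_gt0 b_ge2 alpha_gt0 alpha_lt; have b1 := ratio_lt1 b_ge2 alpha_gt0.
have x1 : 1 <= (beta ^+ (J0 + v))^-1.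
  by rewrite invf_ge1 ?exprn_gt0// exprn_ile1// ltW.
have := truncnS_gt (beta ^+ (J0 + v))^-1; rewrite -/(freqs v) => xf.
have f1 : (1 <= freqs v)%N by rewrite -ltnS -(ltr_nat R) (le_lt_trans x1).
apply: (le_trans (ltW xf)); rewrite -natrM ler_nat; lia.
Qed.

Lemma freqs_gt0 v : (0 < freqs v)%N.
Proof.
have := freqs_ge v; rewrite lt0n; case: eqP => // ->.
by rewrite mulr0 leNgt invr_gt0 exprn_gt0// ratio_gt0.
Qed.

(** Second use of [alpha < 1/2]: the sum of all frequencies, which weights the diagonal pairs, stays
    below the number of grid points. *)
Lemma freqs_sq_le v : (freqs v)%:R ^+ 2 <= (b ^ (J0 + v))%:R :> R.
Proof.
have b0 := ratio_gt0 b_ge2 alpha_gt0 alpha_lt.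
apply: (@le_trans _ _ ((beta ^+ (J0 + v))^-1 ^+ 2)).
  by rewrite lerXn2r ?nnegrE ?invr_ge0 ?exprn_ge0 ?(ltW b0)// freqs_le.
rewrite exprVn -[leLHS]mul1r ler_pdivrMr ?exprn_gt0// natrX exprAC -exprMn.
by rewrite exprn_ege1// base_ratio_sq_ge1.
Qed.

Lemma freqs_le_pow v : (freqs v <= b ^ (J0 + v))%N.
Proof.
rewrite -(ler_nat R) (le_trans _ (freqs_sq_le v))// -natrX ler_nat.
by rewrite -[leqLHS]expn1 leq_pexp2l ?freqs_gt0.
Qed.

Lemma energy_open (M v : nat) (tau : R) :
  lip_open [set g : R -> R | Lip g /\ tau < energy g M v].
Proof.
split=> [g []//|g [Lg taug]].
have b1 : 0 < 1 - beta by rewrite subr_gt0 ratio_lt1.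
pose K : R := \sum_(0 <= a < b ^ J0) \sum_(1 <= d < freqs v)
  d%:R * ((b ^ v)%:R ^+ 2 * (2 * d%:R)).
have K0 : 0 <= K by rewrite /K; do 2 (apply: sumr_ge0 => ? _).
(* [1 - beta] cancels the bound of [weierstrass_lip_norm], and [K] is the Lipschitz constant of the
   energy in the samples. *)
pose e := (energy g M v - tau) / (K + 1) * (1 - beta).
have e0 : 0 < e by rewrite mulr_gt0// divr_gt0 ?subr_gt0// ltr_wpDl.
exists e; split => // h Lh he; split => //.
have close a k : `|sample g M v a k - sample h M v a k| <= e / (1 - beta).
  rewrite /sample -mulrBl normrM (ger0_norm (x := M.+1%:R^-1)) ?invr_ge0//.
  apply: (@le_trans _ _ `|W g (grid v a k) - W h (grid v a k)|).
    by rewrite ler_piMr// invf_le1 ?ltr0n// ler1n.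
  rewrite distrC (le_trans (weierstrass_lip_norm b_ge2 alpha_gt0 alpha_lt _ Lh Lg))//.
  by rewrite ler_pM2r ?invr_gt0// ltW.
have : energy g M v - energy h M v <= K * (e / (1 - beta)).
  rewrite /energy -sumrB /K mulr_suml; apply: ler_sum => a _.
  rewrite -sumrB mulr_suml; apply: ler_sum => d _.
  rewrite -mulrBr -mulrA ler_wpM2l// (le_trans (ler_norm _))//.
  by rewrite (le_trans (pair_cos_dist_le d (fun k _ => close a k)))// mulrA.
have -> : e / (1 - beta) = (energy g M v - tau) / (K + 1).
  by rewrite /e mulfK// gt_eqF.
set D := energy g M v - tau.
have D0 : 0 < D by rewrite subr_gt0.
have : K * (D / (K + 1)) < D.
  by rewrite mulrCA gtr_pMr// ltr_pdivrMr ?mul1r ?ltrDl// ltr_wpDl.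
by move: D0; rewrite /D; lra.
Qed.

Lemma count_iota_arcs (P : pred nat) (m n : nat) :
  (count P (iota 0 (m * n)) = \sum_(0 <= a < m) \sum_(0 <= k < n) P (a * n + k))%N.
Proof.
elim: m => [|m IHm]; first by rewrite big_geq.
rewrite big_nat_recr//= -IHm mulSn addnC iotaD count_cat add0n; congr (_ + _)%N.
have := iotaDl (m * n) 0 n; rewrite addn0 => ->; rewrite count_map -sum1_count big_mkcond/=.
by rewrite /index_iota subn0; apply: eq_bigr => k _; case: (P _).
Qed.

Lemma sum_freq_bound_le (g : R -> R) (M v : nat) :
  \sum_(0 <= a < b ^ J0) \sum_(0 <= d < freqs v) freq_bound (b ^ v) (sample g M v a) d <=
  (b ^ J0)%:R * ((b ^ v)%:R * (1 + (J0 + v)%:R * b%:R)) + energy g M v / (b ^ v)%:R.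
Proof.
have N0 : 0 < (b ^ v)%:R :> R by rewrite ltr0n expn_gt0 b_gt0.
rewrite /energy mulr_suml.
have -> : (b ^ J0)%:R * ((b ^ v)%:R * (1 + (J0 + v)%:R * b%:R)) =
    \sum_(0 <= a < b ^ J0) ((b ^ v)%:R * (1 + (J0 + v)%:R * b%:R)) :> R.
  by rewrite big_const_nat subn0 iter_addr addr0 mulr_natl.
rewrite -big_split/=; apply: ler_sum => a _.
rewrite big_ltn ?freqs_gt0// {1}/freq_bound eqxx mulrDr mulr1 -addrA lerD2l.
apply: (@le_trans _ _ (\sum_(1 <= d < freqs v)
    ((b ^ v)%:R / d%:R + d%:R * pair_cos (b ^ v) (sample g M v a) d / (b ^ v)%:R))).
  apply: ler_sum_nat => d /andP[d1 _]; rewrite /freq_bound gtn_eqF//.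
  rewrite ler_pdivrMr// ler_peMr ?ler1n// addr_ge0 ?divr_ge0//.
  by rewrite mulr_ge0 ?pair_cos_ge0.
rewrite big_split/= lerD//; last by rewrite mulr_suml.
rewrite -mulr_sumr ler_pM2l//.
by apply: harmonic_le; [exact: b_gt0|exact: freqs_le_pow].
Qed.

(** Dividing the Fejer bound by the number of frequencies, of order [beta ^- n], turns [b ^ n] into
    [b ^ (n (1 - alpha))]. The 16 is the 8 of [fejer_count] times the 2 of [freqs_ge]. *)
Lemma cell_count_le (g : R -> R) (M v : nat) (y C : R) :
  (forall n x z, b%:R ^+ n * `|x - z| <= 1 -> `|W g x - W g z| <= beta ^+ n * M.+1%:R) ->
  0 <= C -> energy g M v <= C * energy_scale v ->
  (cell_count (level_set (W g) y) (b ^ (J0 + v)))%:R <=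
    (16 * (1 + b%:R + C)) * (b%:R ^+ (J0 + v)) `^ (1 - alpha) * (J0 + v).+1%:R ^+ 4.
Proof.
move=> Wh C0 enC; set n := (J0 + v)%N.
have b0 := ratio_gt0 b_ge2 alpha_gt0 alpha_lt.
have N0 : 0 < (b ^ v)%:R :> R by rewrite ltr0n expn_gt0 b_gt0.
have A0 : 0 < (b ^ J0)%:R :> R by rewrite ltr0n expn_gt0 b_gt0.
have J0' : 0 < (freqs v)%:R :> R by rewrite ltr0n freqs_gt0.
have step1 : (cell_count (level_set (W g) y) (b ^ n))%:R * (freqs v)%:R <=
    8 * \sum_(0 <= a < b ^ J0) \sum_(0 <= d < freqs v) freq_bound (b ^ v) (sample g M v a) d.
  rewrite /cell_count /n expnD count_iota_arcs natr_sum mulr_suml mulr_sumr.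
  apply: ler_sum_nat => a /andP[_ aA].
  apply: le_trans (fejer_count (sample g M v a) (y / M.+1%:R) _ (freqs_gt0 v)); last first.
    by rewrite expn_gt0 b_gt0.
  rewrite ler_pM2r// natr_sum; apply: ler_sum => k _.
  case: asboolP => [[x [[/andP[x0 x1] Wx] xk]]|_] /=; last by rewrite mulr0n ler0n.
  (* If the cell meets the level set at [x], its left end is within [b ^- n] of [x], so its sample
     is within [beta ^+ n], hence within [1 / freqs v], of [y / M.+1]. *)
  rewrite (_ : (_ <= 1)%R = true)//.
  have gx : b%:R ^+ n * `|grid v a k - x| <= 1.
    have bn : 0 < b%:R ^+ n :> R by rewrite exprn_gt0.
    move: xk; rewrite /grid -expnD natrX => /andP[xk1 xk2].
    have : b%:R ^+ n * x < (a * b ^ v + k)%:R + 1.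
      by rewrite mulrC -ltr_pdivlMr// natr1.
    have : (a * b ^ v + k)%:R <= b%:R ^+ n * x.
      by rewrite mulrC -ler_pdivrMr.
    rewrite -[X in X * `|_|](gtr0_norm bn) -normrM mulrBr mulrCA divff ?gt_eqF// mulr1.
    by move=> ? ?; rewrite ler_norml; apply/andP; split; lra.
  have := Wh n _ _ gx; rewrite Wx => H.
  rewrite /sample -mulrBl normrM (ger0_norm (x := M.+1%:R^-1)) ?invr_ge0//.
  rewrite mulrAC ler_pdivrMr ?ltr0n// mul1r.
  rewrite (le_trans (ler_wpM2l (normr_ge0 _) (freqs_le v)))//.
  by rewrite ler_pdivrMr ?exprn_gt0// mulrC.
have step2 := le_trans step1 (ler_wpM2l (ler0n _ _) (sum_freq_bound_le g M v)).
have NE : (b%:R ^+ n) `^ (1 - alpha) = b%:R ^+ n * beta ^+ n.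
  rewrite powRD; last by rewrite (gt_eqF (exprn_gt0 _ base_gt0)) implybT.
  rewrite powRr1 ?exprn_ge0//; congr (_ * _).
  elim: (n) => [|m IHm]; first by rewrite !expr0 powR1.
  by rewrite exprS powRM ?exprn_ge0// IHm -exprS.
rewrite NE; set c : R := (cell_count _ _)%:R in step2 *.
have c0 : 0 <= c by rewrite ler0n.
have bn0 : 0 < beta ^+ n by rewrite exprn_gt0.
have F2 : 1 <= beta ^+ n * (2 * (freqs v)%:R).
  by have := freqs_ge v; rewrite -/n -[in X in X -> _](mul1r (_^-1)) ler_pdivrMr// mulrC.
have en : energy g M v / (b ^ v)%:R <= C * ((b ^ v)%:R * v.+1%:R ^+ 4).
  rewrite ler_pdivrMr// (le_trans enC)// /energy_scale le_eqVlt.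
  by apply/orP; left; apply/eqP; ring.
have bnE : (b ^ J0)%:R * (b ^ v)%:R = b%:R ^+ n :> R by rewrite -natrM -expnD natrX.
have bn1 : (b ^ v)%:R <= b%:R ^+ n :> R.
  by rewrite -bnE ler_peMl ?ler0n// ler1n expn_gt0 b_gt0.
set T : R := n.+1%:R; have T1 : 1 <= T by rewrite ler1n.
have T4 : T <= T ^+ 4 by rewrite -[leLHS]expr1 ler_weXn2l.
have h1 : (b ^ J0)%:R * ((b ^ v)%:R * (1 + n%:R * b%:R)) <=
    b%:R ^+ n * ((1 + b%:R) * T ^+ 4) :> R.
  rewrite mulrA bnE ler_wpM2l ?exprn_ge0//.
  apply: (@le_trans _ _ ((1 + b%:R) * T)); last by rewrite ler_wpM2l// addr_ge0.
  have : 0 <= n%:R :> R by []; have := ltW base_gt0; rewrite /T -natr1; nra.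
have h2 : C * ((b ^ v)%:R * v.+1%:R ^+ 4) <= b%:R ^+ n * (C * T ^+ 4).
  rewrite [leRHS]mulrCA ler_wpM2l// ler_pM ?exprn_ge0//.
  by rewrite lerXn2r ?nnegrE// ler_nat ltnS leq_addl.
have h3 : c * (freqs v)%:R <= 8 * (b%:R ^+ n * ((1 + b%:R + C) * T ^+ 4)).
  apply: (le_trans step2); rewrite ler_pM2l//.
  apply: (le_trans (lerD h1 (le_trans en h2))).
  by rewrite -mulrDr -mulrDl.
apply: (@le_trans _ _ (c * (beta ^+ n * (2 * (freqs v)%:R)))); first by rewrite ler_peMr.
have -> : c * (beta ^+ n * (2 * (freqs v)%:R)) = 2 * beta ^+ n * (c * (freqs v)%:R) by ring.
apply: (@le_trans _ _ (2 * beta ^+ n * (8 * (b%:R ^+ n * ((1 + b%:R + C) * T ^+ 4))))).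
  by rewrite ler_pM2l// mulr_gt0.
by rewrite le_eqVlt; apply/orP; left; apply/eqP; ring.
Qed.

End Energy.

(** * Expected energies under a translated probe *)

Section ExpectationOfSums.
Variables (R : realType) (d : measure_display) (T : measurableType d) (P : probability T R).
Variables (m n : nat) (f : nat -> T -> R).
Hypothesis intf : forall i, P.-integrable setT (fun w => (f i w)%:E).

Lemma integrable_sumr : P.-integrable setT (fun w => (\sum_(m <= i < n) f i w)%:E).
Proof. by under eq_fun do rewrite -sumEFin; apply: integrable_sum. Qed.

Lemma integral_sumr_le (c : nat -> R) :
  (forall i, (m <= i < n)%N -> (\int[P]_w (f i w)%:E <= (c i)%:E)%E) ->
  (\int[P]_w (\sum_(m <= i < n) f i w)%:E <= (\sum_(m <= i < n) c i)%:E)%E.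
Proof.
move=> fc; under eq_integral do rewrite -sumEFin.
rewrite integral_sum// -sumEFin big_nat [leRHS]big_nat.
by apply: lee_sum => i /fc.
Qed.

End ExpectationOfSums.

Section ExpectedEnergy.
Variables (R : realType) (b : nat) (alpha : R).
Hypotheses (b_ge2 : (2 <= b)%N) (alpha_gt0 : 0 < alpha) (alpha_lt : alpha < 1 / 2).
Local Notation beta := ((b%:R : R) `^ (- alpha)).
Local Notation W := (weierstrass alpha b).
Variable J0 : nat.
Hypothesis J0_large : rise_const b alpha + tail_const b alpha + 1 <= (beta ^+ J0)^-1.

Let b_gt0 : (0 < b)%N. Proof. exact: ltnW. Qed.

(* Every probe function is used twice, so that the characteristic function of
   the difference of two samples decays like [theta ^- 2] instead of [theta ^- 1]. *)
Definition twin_probe (i : nat) : R -> R := probe b J0 i./2.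
Definition probe_dim : nat := (2 * b ^ J0.+2)%N.

Lemma twin_probe_periodic i : periodic1 (twin_probe i).
Proof. exact: probe_periodic. Qed.

Lemma twin_probe_le1 i x : `|twin_probe i x| <= 1.
Proof. exact: (probe_norm_le1 b_ge2 alpha_gt0 alpha_lt). Qed.

Lemma twin_probe_lip i x y : `|twin_probe i x - twin_probe i y| <= `|x - y|.
Proof. exact: (probe_lipschitz b_ge2 alpha_gt0 alpha_lt). Qed.

(** The twin factors [2 q] and [2 q + 1] give [2 / |theta|] each; all others are at most 1. *)
Lemma prod_decay_le (theta : nat -> R) (q D : nat) : (q.*2.+1 < D)%N ->
  theta q.*2.+1 = theta q.*2 -> theta q.*2 != 0 ->
  `|\prod_(0 <= i < D) uniform_decay (theta i)| <= 4 / theta q.*2 ^+ 2.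
Proof.
move=> qD twin t0; set x := theta q.*2.
have le1 m n : `|\prod_(m <= i < n) uniform_decay (theta i)| <= 1.
  by rewrite normr_prod prodr_ile1// => i _; rewrite normr_ge0 uniform_decay_le1.
have xp : 0 < `|x| by rewrite normr_gt0.
have dx : `|uniform_decay x| <= 2 / `|x| by rewrite ler_pdivlMr// uniform_decay_mul_le2.
have -> : 4 / x ^+ 2 = 1 * (2 / `|x| * (2 / `|x| * 1)).
  by rewrite -(real_normK (num_real x)); field; rewrite gt_eqF.
rewrite (big_cat_nat (n := q.*2))//=; last by rewrite ltnW// ltnW.
rewrite (@big_ltn _ _ _ q.*2); last exact: ltnW.
rewrite (@big_ltn _ _ _ q.*2.+1)// twin -/x !normrM.
by rewrite ler_pM ?mulr_ge0// ler_pM ?mulr_ge0// ler_pM.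
Qed.

Variables (d : measure_display) (T : measurableType d) (P : probability T R)
  (t : nat -> T -> R).
Hypotheses (mt : forall i, measurable_fun setT (t i))
  (charac : forall (theta : nat -> R) (c : R),
    (\int[P]_w (cos (c + \sum_(0 <= i < probe_dim) theta i * t i w))%:E =
    (\prod_(0 <= i < probe_dim) uniform_decay (theta i) *
      cos (c + \sum_(0 <= i < probe_dim) theta i / 2))%:E)%E).
Variable x0 : R -> R.
Hypothesis Lip_x0 : Lip x0.

Definition shifted (w : T) : R -> R := random_comb probe_dim twin_probe t w \- x0.

Lemma weierstrass_shifted w x :
  W (shifted w) x = \sum_(0 <= i < probe_dim) W (twin_probe i) x * t i w - W x0 x.
Proof.
rewrite (weierstrassB b_ge2 alpha_gt0 alpha_lt)//; last first.
  exact: Lip_comb twin_probe_periodic twin_probe_lip _.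
rewrite (weierstrass_comb b_ge2 alpha_gt0 alpha_lt) => [|i y]; last exact: twin_probe_le1.
by congr (_ - _); apply: eq_bigr => i _; rewrite mulrC.
Qed.

Lemma measurable_sample M v a k :
  measurable_fun setT (fun w => sample b alpha J0 (shifted w) M v a k).
Proof.
apply: measurable_funM => //; under eq_fun do rewrite weierstrass_shifted.
by apply: measurable_funB => //; exact: measurable_lincomb.
Qed.

Lemma measurable_pair M v a n k l :
  measurable_fun setT (fun w => n%:R *
    (sample b alpha J0 (shifted w) M v a k - sample b alpha J0 (shifted w) M v a l)).
Proof.
by apply: measurable_funM => //; apply: measurable_funB; exact: measurable_sample.
Qed.

(** 4 comes from the two twin factors, [M.+1 ^+ 2] from the normalization of samples, [mesh ^+ 2]
    from [probe_separates]. *)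
Definition pair_const (M : nat) : R := 4 * M.+1%:R ^+ 2 / mesh R b J0 ^+ 2.

Lemma pair_const_ge0 M : 0 <= pair_const M.
Proof.
have ? := ltW (mesh_gt0 b_ge2 alpha_gt0 alpha_lt J0).
by rewrite /pair_const divr_ge0 ?mulr_ge0.
Qed.

(** The argument of the cosine is affine in the coefficients [t i], and [x0] enters only its
    constant term [c]. The bound is therefore the same for all translates. *)
Lemma expected_cos_le M v a n k l : (0 < n)%N -> (k < l)%N -> (l < b ^ v)%N ->
  (\int[P]_w (cos (n%:R * (sample b alpha J0 (shifted w) M v a k -
      sample b alpha J0 (shifted w) M v a l)))%:E
   <= (pair_const M * (b ^ (J0 + v))%:R / n%:R ^+ 2 / (l - k)%:R)%:E)%E.
Proof.
move=> n0 kl lN; set x : R := grid R b J0 v a k; set y : R := grid R b J0 v a l.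
have N0 : 0 < (b ^ (J0 + v))%:R :> R by rewrite ltr0n expn_gt0 b_gt0.
have lk0 : 0 < (l - k)%:R :> R by rewrite ltr0n subn_gt0.
have np : 0 < n%:R :> R by rewrite ltr0n.
have yxE : y - x = (l - k)%:R / (b ^ (J0 + v))%:R.
  by rewrite /x /y /grid -mulrBl -natrB ?leq_add2l 1?ltnW// subnDl.
have xy : x < y by rewrite -subr_gt0 yxE divr_gt0.
have yxJ : y - x <= b%:R ^- J0.
  rewrite yxE ler_pdivrMr// expnD natrM natrX mulrA mulVf ?mul1r.
    by rewrite ler_nat (leq_trans (leq_subr _ _))// ltnW.
  by rewrite gt_eqF// exprn_gt0// ltr0n.
have [q qQ sep] := probe_separates b_ge2 alpha_gt0 alpha_lt J0_large xy yxJ.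
pose theta i := n%:R / M.+1%:R * (W (twin_probe i) x - W (twin_probe i) y).
pose c := n%:R / M.+1%:R * (W x0 y - W x0 x).
have argE w : n%:R * (sample b alpha J0 (shifted w) M v a k -
    sample b alpha J0 (shifted w) M v a l) =
    c + \sum_(0 <= i < probe_dim) theta i * t i w.
  rewrite /sample !weierstrass_shifted -/x -/y.
  have -> : \sum_(0 <= i < probe_dim) theta i * t i w = n%:R / M.+1%:R *
      (\sum_(0 <= i < probe_dim) W (twin_probe i) x * t i w -
       \sum_(0 <= i < probe_dim) W (twin_probe i) y * t i w).
    rewrite -sumrB mulr_sumr; apply: eq_bigr => i _.
    by rewrite /theta -mulrA mulrBl.
  by rewrite /c; ring.
under eq_integral do rewrite argE.
rewrite charac lee_fin.
have twinE : theta q.*2.+1 = theta q.*2.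
  by rewrite /theta /twin_probe /= uphalf_double doubleK.
have thetaE : theta q.*2 ^+ 2 = n%:R ^+ 2 / M.+1%:R ^+ 2 *
    (W (probe b J0 q) y - W (probe b J0 q) x) ^+ 2.
  rewrite /theta /twin_probe doubleK exprMn expr_div_n; congr (_ * _).
  by rewrite -[LHS]sqrrN opprB.
have mesh0 : 0 < mesh R b J0 by exact: (mesh_gt0 b_ge2 alpha_gt0 alpha_lt).
have low : n%:R ^+ 2 / M.+1%:R ^+ 2 * (mesh R b J0 ^+ 2 * (y - x)) <= theta q.*2 ^+ 2.
  by rewrite thetaE ler_wpM2l// divr_ge0// exprn_ge0.
have low0 : 0 < n%:R ^+ 2 / M.+1%:R ^+ 2 * (mesh R b J0 ^+ 2 * (y - x)).
  by rewrite mulr_gt0 ?divr_gt0 ?exprn_gt0// mulr_gt0 ?exprn_gt0// subr_gt0.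
have th0 : theta q.*2 != 0.
  by rewrite -sqrf_eq0 gt_eqF// (lt_le_trans low0).
have qD : (q.*2.+1 < probe_dim)%N by rewrite /probe_dim mul2n -doubleS leq_double.
apply: le_trans (ler_norm _) _; rewrite normrM.
apply: (@le_trans _ _ (4 / theta q.*2 ^+ 2 * 1)).
  by rewrite ler_pM// ?cos_max// prod_decay_le.
rewrite mulr1; apply: (@le_trans _ _
  (4 / (n%:R ^+ 2 / M.+1%:R ^+ 2 * (mesh R b J0 ^+ 2 * (y - x))))).
  by rewrite ler_pM2l// lef_pV2// posrE// (lt_le_trans low0).
rewrite yxE /pair_const le_eqVlt; apply/orP; left; apply/eqP; field.
by rewrite !gt_eqF.
Qed.

Definition distn_weight (K : R) (s : nat) : R := if s == 0 then 1 else K / s%:R.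

Lemma expected_cos_distn_le M v a n k l : (0 < n)%N -> (k < b ^ v)%N -> (l < b ^ v)%N ->
  (\int[P]_w (cos (n%:R * (sample b alpha J0 (shifted w) M v a k -
      sample b alpha J0 (shifted w) M v a l)))%:E
   <= (distn_weight (pair_const M * (b ^ (J0 + v))%:R / n%:R ^+ 2)
        (if (l < k)%N then k - l else l - k)%N)%:E)%E.
Proof.
move=> n0 kN lN; rewrite /distn_weight; case: (ltngtP l k) => [lk|kl|->].
- rewrite subn_eq0 leqNgt lk/=; apply: le_trans (expected_cos_le M a n0 lk kN).
  rewrite le_eqVlt; apply/orP; left; apply/eqP; apply: eq_integral => w _.
  by rewrite -cosN -mulrN opprB.
- by rewrite subn_eq0 leqNgt kl/=; exact: expected_cos_le.
- rewrite subnn eqxx; under eq_integral do rewrite subrr mulr0 cos0.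
  by rewrite integral_cst_probability.
Qed.

Lemma integrable_pair M v a n k l :
  P.-integrable setT (fun w => (cos (n%:R * (sample b alpha J0 (shifted w) M v a k -
      sample b alpha J0 (shifted w) M v a l)))%:E).
Proof. by apply: integrable_cos_comp; exact: measurable_pair. Qed.

Lemma integrable_pair_cos M v a n :
  P.-integrable setT (fun w => (pair_cos (b ^ v) (sample b alpha J0 (shifted w) M v a) n)%:E).
Proof.
by apply: integrable_sumr => k; apply: integrable_sumr => l; exact: integrable_pair.
Qed.

Lemma expected_pair_cos_le M v a n : (0 < n)%N ->
  (\int[P]_w (pair_cos (b ^ v) (sample b alpha J0 (shifted w) M v a) n)%:E <=
   ((b ^ v)%:R * (2 * (1 + pair_const M * (b ^ (J0 + v))%:R / n%:R ^+ 2 * (v%:R * b%:R))))%:E)%E.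
Proof.
move=> n0; set K := pair_const M * _ / _.
have K0 : 0 <= K by rewrite divr_ge0 ?exprn_ge0// mulr_ge0 ?pair_const_ge0.
have -> : (b ^ v)%:R * (2 * (1 + K * (v%:R * b%:R))) =
    \sum_(0 <= k < b ^ v) (2 * (1 + K * (v%:R * b%:R))) :> R.
  by rewrite big_const_nat subn0 iter_addr addr0 mulr_natl.
apply: integral_sumr_le => k.
  by apply: integrable_sumr => l; exact: integrable_pair.
move=> /andP[_ kN].
apply: (@le_trans _ _ (\sum_(0 <= l < b ^ v)
    distn_weight K (if (l < k)%N then k - l else l - k)%N)%:E).
  apply: integral_sumr_le => l; first exact: integrable_pair.
  by move=> /andP[_ lN]; exact: expected_cos_distn_le.
rewrite lee_fin (le_trans (sum_distn_le _ kN))//.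
  by move=> s; rewrite /distn_weight; case: eqP => // _; rewrite divr_ge0.
rewrite ler_pM2l// big_ltn ?(leq_ltn_trans _ kN)// {1}/distn_weight eqxx lerD2l.
apply: (@le_trans _ _ (\sum_(1 <= s < b ^ v) (K * s%:R^-1))).
  by apply: ler_sum_nat => s /andP[s1 _]; rewrite /distn_weight gtn_eqF.
by rewrite -mulr_sumr ler_wpM2l// harmonic_le.
Qed.

Definition energy_const M : R :=
  2 * (b ^ J0)%:R ^+ 2 * (1 + pair_const M * b%:R ^+ 2) * J0.+1%:R ^+ 2.

Lemma integrable_energy M v :
  P.-integrable setT (fun w => (energy b alpha J0 (shifted w) M v)%:E).
Proof.
apply: integrable_sumr => a; apply: integrable_sumr => n.
by under eq_fun do rewrite EFinM; apply: integrableZl => //; exact: integrable_pair_cos.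
Qed.

(** Diagonal pairs contribute the sum of the frequencies, bounded by [freqs_sq_le]. Off-diagonal
    pairs contribute two harmonic sums, over index differences and over frequencies, hence the two
    powers of [v.+1]. *)
Lemma expected_energy_le M v :
  (\int[P]_w (energy b alpha J0 (shifted w) M v)%:E <=
   (energy_const M * ((b ^ v)%:R ^+ 2 * v.+1%:R ^+ 2))%:E)%E.
Proof.
set N : R := (b ^ (J0 + v))%:R; set c := pair_const M.
have N0 : 0 < N by rewrite ltr0n expn_gt0 b_gt0.
have c0 : 0 <= c by exact: pair_const_ge0.
pose F := freqs b alpha J0 v.
have step : (\int[P]_w (energy b alpha J0 (shifted w) M v)%:E <=
    (\sum_(0 <= a < b ^ J0) \sum_(1 <= n < F)
      (n%:R * ((b ^ v)%:R * (2 * (1 + c * N / n%:R ^+ 2 * (v%:R * b%:R))))))%:E)%E.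
  have intn a n : P.-integrable setT (fun w =>
      (n%:R * pair_cos (b ^ v) (sample b alpha J0 (shifted w) M v a) n)%:E).
    by under eq_fun do rewrite EFinM; apply: integrableZl => //; exact: integrable_pair_cos.
  apply: integral_sumr_le => a; first by apply: integrable_sumr.
  move=> _; apply: integral_sumr_le => n //; move=> /andP[n0 _].
  under eq_integral do rewrite EFinM.
  rewrite integralZl//; last exact: integrable_pair_cos.
  by rewrite EFinM lee_pmul2l ?lte_fin ?ltr0n//; exact: expected_pair_cos_le.
apply: (le_trans step); rewrite lee_fin.
rewrite big_const_nat subn0 iter_addr addr0 -[leLHS]mulr_natl.
have inner : \sum_(1 <= n < F) (n%:R * ((b ^ v)%:R * (2 * (1 + c * N / n%:R ^+ 2 * (v%:R * b%:R)))))
    <= 2 * (b ^ v)%:R * (N * (1 + c * b%:R ^+ 2 * (v%:R * (J0 + v)%:R))).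
  apply: (@le_trans _ _ (2 * (b ^ v)%:R * \sum_(1 <= n < F)
      (n%:R + c * N * (v%:R * b%:R) * n%:R^-1))).
    rewrite mulr_sumr; apply: ler_sum_nat => n /andP[n0 _].
    have np : n%:R != 0 :> R by rewrite pnatr_eq0 -lt0n.
    by rewrite le_eqVlt; apply/orP; left; apply/eqP; field.
  rewrite ler_wpM2l ?mulr_ge0// big_split/= -mulr_sumr mulrDr mulr1 lerD//.
    apply: le_trans (freqs_sq_le b_ge2 alpha_gt0 alpha_lt J0 v).
    apply: (@le_trans _ _ (\sum_(1 <= n < F) F%:R)).
      by apply: ler_sum_nat => n /andP[_ nF]; rewrite ler_nat ltnW.
    rewrite big_const_nat iter_addr addr0 -[_ *+ (F - 1)]mulr_natl expr2 ler_wpM2r//.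
    by rewrite ler_nat leq_subr.
  have -> : N * (c * b%:R ^+ 2 * (v%:R * (J0 + v)%:R)) =
      c * N * (v%:R * b%:R) * ((J0 + v)%:R * b%:R) by ring.
  apply: ler_wpM2l.
    by apply: mulr_ge0; [apply: mulr_ge0 => //; exact: ltW|exact: mulr_ge0].
  by apply: harmonic_le => //; exact: freqs_le_pow.
apply: (le_trans (ler_wpM2l (ler0n _ _) inner)).
have -> : (b ^ J0)%:R * (2 * (b ^ v)%:R * (N * (1 + c * b%:R ^+ 2 * (v%:R * (J0 + v)%:R)))) =
    2 * (b ^ J0)%:R ^+ 2 * (b ^ v)%:R ^+ 2 * (1 + c * b%:R ^+ 2 * (v%:R * (J0 + v)%:R)) :> R.
  by rewrite /N expnD natrM; ring.
have -> : energy_const M * ((b ^ v)%:R ^+ 2 * v.+1%:R ^+ 2) =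
    2 * (b ^ J0)%:R ^+ 2 * (b ^ v)%:R ^+ 2 *
    ((1 + c * b%:R ^+ 2) * (J0.+1%:R ^+ 2 * v.+1%:R ^+ 2)).
  by rewrite /energy_const -/c; ring.
apply: ler_wpM2l; first by rewrite mulr_ge0 ?exprn_ge0// mulr_ge0// exprn_ge0.
set r : R := J0.+1%:R ^+ 2 * v.+1%:R ^+ 2.
have rE : r = ((J0.+1 * v.+1) ^ 2)%:R by rewrite /r -exprMn -natrM natrX.
have r1 : 1 <= r by rewrite rE ler1n expn_gt0.
have vr : v%:R * (J0 + v)%:R <= r by rewrite rE -natrM ler_nat; nia.
rewrite mulrDl mul1r lerD//; apply: ler_wpM2l => //.
by apply: mulr_ge0 => //; exact: exprn_ge0.
Qed.

Lemma energy_ge0 g M v : 0 <= energy b alpha J0 g M v.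
Proof.
by apply: sumr_ge0 => a _; apply: sumr_ge0 => n _; rewrite mulr_ge0// pair_cos_ge0.
Qed.

Lemma energy_tail M v (C : R) : 0 < C ->
  (P [set w | (C * energy_scale R b v < energy b alpha J0 (shifted w) M v)%R]
    <= (energy_const M / C * v.+1%:R ^- 2)%:E)%E.
Proof.
move=> C0; have mE := measurable_int _ (integrable_energy M v).
have Nv : 0 < (b ^ v)%:R :> R by rewrite ltr0n expn_gt0 b_gt0.
have tau0 : 0 < C * energy_scale R b v.
  by rewrite mulr_gt0// mulr_gt0 ?exprn_gt0.
set tau := C * _ in tau0 *.
have mf : measurable_fun setT (fun w => energy b alpha J0 (shifted w) M v).
  exact/measurable_EFinP.
have markov : (tau%:E * P [set w | (tau%:E <= `|(energy b alpha J0 (shifted w) M v)%:E|)%E]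
    <= (energy_const M * ((b ^ v)%:R ^+ 2 * v.+1%:R ^+ 2))%:E)%E.
  have := @le_integral_comp_abse _ _ _ P setT measurableT
    (fun w => (energy b alpha J0 (shifted w) M v)%:E) tau id (@measurable_id _ _ _)
    (fun _ r0 => r0) (fun _ _ _ _ xy => xy) mE tau0.
  rewrite setTI => /le_trans; apply.
  apply: le_trans (expected_energy_le M v); rewrite le_eqVlt; apply/orP; left; apply/eqP.
  by apply: eq_integral => w _; rewrite gee0_abs// lee_fin energy_ge0.
apply: (@le_trans _ _ (P [set w | (tau%:E <= `|(energy b alpha J0 (shifted w) M v)%:E|)%E])).
  apply: le_measure.
  - rewrite inE -[X in measurable X]setTI; apply: measurable_fun_ltr => //.
  - rewrite inE -[X in measurable X]setTI; apply: emeasurable_fun_c_infty => //.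
    exact: measurableT_comp.
  - by move=> w /= /ltW tw; rewrite lee_fin (le_trans tw)// ler_norm.
have -> : energy_const M / C * v.+1%:R ^- 2 =
    energy_const M * ((b ^ v)%:R ^+ 2 * v.+1%:R ^+ 2) / tau.
  rewrite /tau /energy_scale; field.
  by rewrite !gt_eqF.
by rewrite (EFinM _ tau^-1) lee_pdivlMr// muleC.
Qed.

End ExpectedEnergy.

(** * The exceptional set *)

Section Exceptional.
Variables (R : realType) (b : nat) (alpha : R).
Hypotheses (b_ge2 : (2 <= b)%N) (alpha_gt0 : 0 < alpha) (alpha_lt : alpha < 1 / 2).
Local Notation beta := ((b%:R : R) `^ (- alpha)).
Local Notation W := (weierstrass alpha b).
Variable J0 : nat.

(* [M] bounds the Hoelder constant of [W g]. *)
Definition exceptional : set (R -> R) :=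
  \bigcup_M \bigcap_C \bigcup_v
    [set g | Lip g /\ C.+1%:R * energy_scale R b v < energy b alpha J0 g M v].

Lemma exceptional_borel : lip_borel exceptional.
Proof.
have sA : sigma_algebra (@Lip R) (@lip_borel R) by exact: smallest_sigma_algebra.
case: sA => _ sC sU.
(* Countable intersections, obtained from complements relative to [Lip]. *)
have sI (F : nat -> set (R -> R)) : (forall n, F n `<=` @Lip R) ->
    (forall n, lip_borel (F n)) -> lip_borel (\bigcap_n F n).
  move=> FL bF; have -> : \bigcap_n F n = @Lip R `\` \bigcup_n (@Lip R `\` F n).
    apply/seteqP; split => g.
      move=> Fg; split; first exact: (FL 0%N g (Fg 0%N I)).
      by move=> [n _ [_ nF]]; apply: nF; exact: Fg.
    by move=> [Lg nF] n _; apply: contrapT => nFg; apply: nF; exists n.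
  by apply: (sC); apply: (sU) => n; exact: (sC).
apply: (sU) => M; apply: (sI) => C; first by move=> g [v _ []].
apply: (sU) => v.
by apply: sub_gen_smallest; exact: energy_open.
Qed.

(** Telescoping with [v ^-1 - v.+1 ^-1], which makes sense from [v = 1] on; hence the two base
    cases, the first with [0 ^-1 = 0]. *)
Lemma sum_inv_sq_le (n : nat) : \sum_(0 <= v < n) (v.+1%:R ^- 2 : R) <= 2 - n%:R^-1.
Proof.
elim: n => [|[|n] IHn]; first by rewrite big_geq// invr0 subr0.
  by rewrite big_nat1 expr1n invr1; lra.
rewrite big_nat_recr//= (le_trans (lerD IHn (lexx _)))//.
set x : R := n.+1%:R; have -> : n.+2%:R = x + 1 :> R by rewrite natr1.
have xp : 0 < x by rewrite ltr0n.
rewrite -subr_ge0.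
have -> : 2 - (x + 1)^-1 - (2 - x^-1 + (x + 1) ^- 2) = (x * (x + 1) ^+ 2)^-1.
  by field; rewrite !gt_eqF// addr_gt0.
by rewrite invr_ge0 mulr_ge0 ?sqr_ge0// ltW.
Qed.

(** With [M] above the Hoelder constant of [W g], not being exceptional yields one [C] for all
    scales; [M] and [C] are the same for all [y]. *)
Lemma dim_level_set_le (g : R -> R) : Lip g -> ~ exceptional g -> forall y,
  (upper_minkowski_dim (level_set (W g) y) <= (1 - alpha)%:E)%E.
Proof.
move=> Lg ngood y.
have [A gA] := lip_bounded Lg; have [_ [L gL]] := Lg.
pose H := L * rise_const b alpha + 2 * A * tail_const b alpha.
pose M := Num.trunc `|H|.
have Wh n x z : b%:R ^+ n * `|x - z| <= 1 -> `|W g x - W g z| <= beta ^+ n * M.+1%:R.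
  move=> /(weierstrass_hoelder b_ge2 alpha_gt0 alpha_lt gA gL) /le_trans; apply.
  rewrite ler_wpM2l ?exprn_ge0 ?powR_ge0//.
  by rewrite (le_trans (ler_norm _))// ltW// truncnS_gt.
have [C en] : exists C, forall v, energy b alpha J0 g M v <= C.+1%:R * energy_scale R b v.
  apply: contrapT => nC; apply: ngood; exists M => // C _; apply: contrapT => nv.
  apply: nC; exists C => v; rewrite leNgt; apply/negP => vC.
  by apply: nv; exists v.
pose K : R := 16 * (1 + b%:R + C.+1%:R).
apply: (upper_minkowski_dim_le b_ge2 (s := 1 - alpha) (C := K) (n0 := J0)).
- by move=> x [].
- have ? := alpha_lt; lra.
- have : 0 <= b%:R :> R by []; have : 0 <= C.+1%:R :> R by []; rewrite /K; lra.
- move=> n Jn; rewrite -(subnKC Jn).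
  exact: (cell_count_le b_ge2 alpha_gt0 alpha_lt y Wh (ler0n _ _) (en _)).
Qed.

Hypothesis J0_large : rise_const b alpha + tail_const b alpha + 1 <= (beta ^+ J0)^-1.

(** For fixed [M] and [C] the tail bounds sum to a multiple of [1 / C.+1], so the intersection over
    [C] is null; the union over [M] is countable. *)
Lemma exceptional_null (d : measure_display) (T : measurableType d) (P : probability T R)
    (t : nat -> T -> R) (x0 : R -> R) :
  (forall i, measurable_fun setT (t i)) ->
  (forall (theta : nat -> R) (c : R),
    (\int[P]_w (cos (c + \sum_(0 <= i < probe_dim b J0) theta i * t i w))%:E =
    (\prod_(0 <= i < probe_dim b J0) uniform_decay (theta i) *
      cos (c + \sum_(0 <= i < probe_dim b J0) theta i / 2))%:E)%E) ->
  Lip x0 ->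
  P [set w | exceptional (shifted b J0 t x0 w)] = 0%E.
Proof.
move=> mt charac Lx0.
pose E M C v := [set w |
  C.+1%:R * energy_scale R b v < energy b alpha J0 (shifted b J0 t x0 w) M v].
have Lsh w : Lip (shifted b J0 t x0 w).
  apply: Lip_sub => //; apply: Lip_comb.
    exact: twin_probe_periodic.
  exact: (twin_probe_lip b_ge2 alpha_gt0 alpha_lt).
have mE M C v : measurable (E M C v).
  rewrite -[X in measurable X]setTI; apply: measurable_fun_ltr => //.
  apply/measurable_EFinP; apply: (measurable_int P).
  exact: (integrable_energy b_ge2 alpha_gt0 alpha_lt J0 P mt Lx0 M v).
have -> : [set w | exceptional (shifted b J0 t x0 w)] = \bigcup_M \bigcap_C \bigcup_v E M C v.
  apply/seteqP; split=> w /=.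
    by move=> [M _ H]; exists M => // C _; have [v _ [_ ?]] := H C I; exists v.
  by move=> [M _ H]; exists M => // C _; have [v _ ?] := H C I; exists v.
have mU M C : measurable (\bigcup_v E M C v) by exact: bigcupT_measurable.
have mI M : measurable (\bigcap_C \bigcup_v E M C v) by exact: bigcapT_measurable.
have null M : P (\bigcap_C \bigcup_v E M C v) = 0%E.
  have c0 : 0 <= energy_const R b J0 M.
    have ? := pair_const_ge0 b_ge2 alpha_gt0 alpha_lt J0 M.
    rewrite /energy_const; apply: mulr_ge0; last exact: exprn_ge0.
    apply: mulr_ge0; first by apply: mulr_ge0 => //; exact: exprn_ge0.
    by apply: addr_ge0 => //; apply: mulr_ge0 => //; exact: exprn_ge0.
  have bound C : (P (\bigcap_C \bigcup_v E M C v) <= (2 * energy_const R b J0 M / C.+1%:R)%:E)%E.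
    apply: (@le_trans _ _ (P (\bigcup_v E M C v))).
      by apply: le_measure; rewrite ?inE// => w; exact.
    apply: le_trans (measure_sigma_subadditive P (mE M C) (mU M C) (@subset_refl _ _)) _.
    apply: lime_le; first by apply: is_cvg_nneseries => *; exact: measure_ge0.
    apply: nearW => n.
    apply: (@le_trans _ _ (\sum_(0 <= v < n)
      (energy_const R b J0 M / C.+1%:R * v.+1%:R ^- 2)%:E)%E).
      apply: lee_sum => v _.
      exact: (energy_tail b_ge2 alpha_gt0 alpha_lt J0_large mt charac Lx0).
    rewrite sumEFin lee_fin -mulr_sumr -mulrA mulrC ler_wpM2r ?divr_ge0//.
    by rewrite (le_trans (sum_inv_sq_le n))// gerBl invr_ge0.
  apply/eqP; rewrite eq_le measure_ge0 andbT.
  apply/lee_addgt0Pr => e e0; rewrite add0e.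
  apply: le_trans (bound (Num.trunc (2 * energy_const R b J0 M / e))) _.
  rewrite lee_fin ler_pdivrMr// -ler_pdivrMl// mulrC.
  by rewrite ltW// truncnS_gt.
apply/eqP; rewrite eq_le measure_ge0 andbT.
apply: le_trans (measure_sigma_subadditive P mI (bigcupT_measurable _ mI) (@subset_refl _ _)) _.
by rewrite eseries0// => M _ _; exact: null.
Qed.

End Exceptional.

Theorem theorem1p2 (R : realType) (b : nat) (alpha : R) :
  (2 <= b)%N -> 0 < alpha -> alpha < 1 / 2 ->
  lip_prevalent (fun g : R -> R =>
    forall y : R,
      (upper_minkowski_dim (level_set (weierstrass alpha b g) y)
         <= (1 - alpha)%:E)%E).
Proof.
move=> b_ge2 alpha_gt0 alpha_lt.
(* [J0] depends only on [b] and [alpha], so a single probe serves all translates. *)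
have [J0 J0_large] := exists_depth b_ge2 alpha_gt0 alpha_lt
  (rise_const b alpha + tail_const b alpha + 1).
have [d [T [P [t [mt t01 charac]]]]] := iid_uniform R (probe_dim b J0).
have per := twin_probe_periodic (R := R) b J0.
have bd := twin_probe_le1 b_ge2 alpha_gt0 alpha_lt J0.
have lip := twin_probe_lip b_ge2 alpha_gt0 alpha_lt J0.
exists (probe_measure (probe_dim b J0) (twin_probe b J0) t P), (exceptional b alpha J0).
split.
- exact: (probe_measure_borel _ per bd lip mt P).
- exact: (exceptional_borel b_ge2 alpha_gt0 alpha_lt).
- move=> g [Lg ndim]; apply: contrapT => ng; apply: ndim => y.
  exact: (dim_level_set_le b_ge2 alpha_gt0 alpha_lt Lg ng).
- exists (probe_cube (probe_dim b J0) (twin_probe b J0)); split.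
    exact: (probe_cube_compact _ per bd lip).
  suff -> : probe_measure (probe_dim b J0) (twin_probe b J0) t P
      (probe_cube (probe_dim b J0) (twin_probe b J0)) = 1%E by rewrite lte01 ltry.
  (* All coefficients lie in [0, 1] at every sample point, so the cube carries the full mass. *)
  rewrite /probe_measure -[RHS](probability_setT P); congr (P _).
  by apply/seteqP; split => // w _ /=; exists (t ^~ w) => //= i; exact: t01.
- move=> x Lx; rewrite /probe_measure preimage_translate.
  exact: (exceptional_null b_ge2 alpha_gt0 alpha_lt J0_large mt charac Lx).
Qed.
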